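(* Let $K\in\mathbb{K}^{p,q}$ and let $\mathcal{H}$ satisfy the assumptions in the context. There is a constant $C$, independent of $\varepsilon,\tau$ and $T$ (but possibly depending on $\mathcal{H},p,q,K$), such that the following holds. Let $N\ge1$ be an integer, $\triangle t=T/N$ with $\triangle t\le 2/3$, $t_n=n\triangle t$, $t_{n+1/2}=(t_n+t_{n+1})/2$, and let $0<\varepsilon<\tau<\triangle t$, $\varepsilon<1$. Let $\mathbf{F}$ be the upscaled flux defined in the context (exact solution of the micro problem). Suppose $\{\mathbf{M}_n\}_{n=0}^N\subset\mathbb{R}^3$ satisfies $$\mathbf{M}_{n+1}=\mathbf{M}_n+\triangle t\,\mathbf{F}(t_{n+1/2},\mathbf{M}_{n+1/2}),\qquad \mathbf{M}_{n+1/2}=\tfrac12(\mathbf{M}_n+\mathbf{M}_{n+1}),\qquad 0\le n\le N-1,$$ and $\{\bar{\mathbf{m}}_n\}_{n=0}^N\subset\mathbb{R}^3$ satisfies $$\bar{\mathbf{m}}_{n+1}=\bar{\mathbf{m}}_n-\triangle t\,\bar{\mathcal{H}}(t_{n+1/2})\bar{\mathbf{m}}_{n+1/2},\qquad \bar{\mathbf{m}}_{n+1/2}=\tfrac12(\bar{\mathbf{m}}_n+\bar{\mathbf{m}}_{n+1}),\qquad 0\le n\le N-1,$$ with the same initial value $\mathbf{M}_0=\bar{\mathbf{m}}_0$, $|\mathbf{M}_0|=1$. Then the error $\mathbf{e}_n:=\mathbf{M}_n-\bar{\mathbf{m}}_n$ satisfies $$|\mathbf{e}_N|\le C\sqrt{T}\left(\tau+\left(\frac{\varepsilon}{\tau}\right)^{q+2}\right)e^{\frac34T}\max_{0\le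 n\le N-1}|\mathbf{M}_{n+1/2}|.$$
   Context: $|\cdot|$ is the Euclidean norm on $\mathbb{R}^3$. Field: $T>0$ and $\mathcal{H}:[0,T]\times\mathbb{R}\to\mathbb{R}^{3\times3}$ is a skew-symmetric matrix function of the form $$\mathcal{H}=\begin{pmatrix}0&H_3&-H_2\\-H_3&0&H_1\\H_2&-H_1&0\end{pmatrix}$$ (so $\mathcal{H}\mathbf{v}=\mathbf{v}\times\mathbf{H}$ with $\mathbf{H}=(H_1,H_2,H_3)$), such that $\mathcal{H}(t,\cdot)$ is $1$-periodic, its entries belong to $C^\infty([0,T]\times[0,1])$, and there is a constant $c_1$ with $|\partial_t^k\mathcal{H}(t,s)\mathbf{v}|\le c_1|\mathbf{v}|$ for $k=0,1$, all $\mathbf{v}\in\mathbb{R}^3$, $t\in[0,T]$, $s\in\mathbb{R}$ ($\partial_t$ is the derivative in the first argument). Put $\bar{\mathcal{H}}(t):=\int_0^1\mathcal{H}(t,s)\,ds$. Kernels: for integers $p\ge 0$, $q\ge-1$, $K\in\mathbb{K}^{p,q}$ means that $K:\mathbb{R}\to\mathbb{R}$ has compact support in $[-1/2,1/2]$, $K(t)=K(-t)$, the weak derivative $K^{(q+1)}$ belongs to $BV(\mathbb{R})$, and $\int_{\mathbb{R}}K(t)\,dt=1$, $\int_{\mathbb{R}}K(t)t^r\,dt=0$ for integers $0<r\le p$. The scaled kernel is $K_\tau(t):=\frac1\tau K(t/\tau)$. Upscaled flux: for $t_a$ with $[t_a-\tau/2,t_a+\tau/2]\subset[0,T]$ and $\mathbf{M}\in\mathbb{R}^3$,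 let $\mathbf{m}^\varepsilon$ be the exact solution of $\frac{d}{dt}\mathbf{m}^\varepsilon(t)=-\mathcal{H}(t,t/\varepsilon)\mathbf{m}^\varepsilon(t)$ on $[t_a-\tau/2,t_a+\tau/2]$ with $\mathbf{m}^\varepsilon(t_a)=\mathbf{M}$ (solved forward and backward from $t_a$), and set $$\mathbf{F}(t_a,\mathbf{M}):=\int_{t_a-\tau/2}^{t_a+\tau/2}K_\tau(s-t_a)\frac{d}{ds}\mathbf{m}^\varepsilon(s)\,ds.$$ *)

(* Defs.v *)
From HB Require Import structures.
From mathcomp Require Export all_boot all_order all_algebra.
From mathcomp Require Export all_classical all_reals all_analysis.

Set Implicit Arguments.
Unset Strict Implicit.
Unset Printing Implicit Defensive.

Import Order.TTheory GRing.Theory Num.Theory.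
Import numFieldNormedType.Exports.

Local Open Scope classical_set_scope.
Local Open Scope ring_scope.

Section definitions.
Context {R : realType}.

Local Notation mu := (@lebesgue_measure R).

(* Euclidean norm; `|v| on matrices is the sup norm. *)
Definition enorm (v : 'cV[R]_3) : R := Num.sqrt (\sum_(i < 3) v i 0 ^+ 2).

Definition diff_quotient {V : normedModType R} (f : R -> V) (x y : R) : V :=
  (y - x)^-1 *: (f y - f x).

(* Derivative relative to A: one-sided at the endpoints when A is a
   nondegenerate interval. *)
Definition is_deriv_in {V : normedModType R}
    (A : set R) (f : R -> V) (x : R) (l : V) : Prop :=
  diff_quotient f x y @[y --> within A x^'] --> l.

Definition deriv_in {V : normedModType R}
    (A : set R) (f : R -> V) (x : R) : V :=
  lim (diff_quotient f x y @[y --> within A x^']).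

(* C^oo up to the boundary of the rectangle A x B; D k l is the partial
   derivative of order k in the first and l in the second variable. *)
Definition smooth_on_rect (A B : set R) (f : R -> R -> R) : Prop :=
  exists D : nat -> nat -> R -> R -> R,
    [/\ forall t s, A t -> B s -> D 0%N 0%N t s = f t s,
        forall k l,
          {within A `*` B, continuous (fun z : R * R => D k l z.1 z.2)},
        forall k l t s, A t -> B s ->
          is_deriv_in A (D k l ^~ s) t (D k.+1 l t s) &
        forall k l t s, A t -> B s ->
          is_deriv_in B (D k l t) s (D k l.+1 t s)].

Definition skew_mx (h1 h2 h3 : R) : 'M[R]_3 :=
  \matrix_(i < 3, j < 3)
    nth 0 (nth [::] [:: [::    0;   h3; - h2];
                        [:: - h3;    0;   h1];
                        [::   h2; - h1;    0]] i) j.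

(* H is a total function, of which only the values on [0, T] x R matter.
   Smoothness is required up to the boundary of the cell [0, T] x [0, 1] only,
   so the s-derivatives of H may jump at integer s. *)
Record is_field (T c1 : R) (H : R -> R -> 'M[R]_3) : Prop := {
  field_skew : forall t s : R, t \in `[0, T] ->
    exists h1 h2 h3, H t s = skew_mx h1 h2 h3 ;
  field_periodic : forall t s : R, t \in `[0, T] -> H t (s + 1) = H t s ;
  field_smooth : forall i j,
    smooth_on_rect `[0, T] `[0, 1] (fun t s => H t s i j) ;
  field_bound : forall (t s : R) v, t \in `[0, T] ->
    enorm (H t s *m v) <= c1 * enorm v ;
  field_bound_dt : forall (t s : R) v, t \in `[0, T] ->
    enorm (deriv_in `[0, T] (H ^~ s) t *m v) <= c1 * enorm v }.

Definition avg_field (H : R -> R -> 'M[R]_3) (t : R) : 'M[R]_3 :=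
  \matrix_(i, j) \int[mu]_(s in `[0, 1]) H t s i j.

Definition compactly_supported (f : R -> R) : Prop :=
  compact (closure [set x | f x != 0]).

Definition test_function (phi : R -> R) : Prop :=
  (forall n x, derivable (derive1n n phi) x 1) /\ compactly_supported phi.

(* g is the n-th weak derivative of f on the line *)
Definition weak_deriv (n : nat) (f g : R -> R) : Prop :=
  [/\ locally_integrable setT f,
      locally_integrable setT g &
      forall phi, test_function phi ->
        \int[mu]_x (f x * derive1n n phi x) = (-1) ^+ n * \int[mu]_x (g x * phi x)].

(* BV(R) in the distributional sense: g in L^1(R) with finite total variation
   sup { int g phi' : phi in C^1_c(R), |phi| <= 1 }. *)
Definition BV (g : R -> R) : Prop :=
  mu.-integrable setT (EFin \o g) /\
  exists V : R, forall phi : R -> R,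
    (forall x, derivable phi x 1) -> continuous (derive1 phi) ->
    compactly_supported phi -> (forall x, `|phi x| <= 1) ->
    \int[mu]_x (g x * derive1 phi x) <= V.

(* The kernel class K^{p,q}; because of absz it is meaningful for -1 <= q only. *)
Record is_kernel (p : nat) (q : int) (K : R -> R) : Prop := {
  kernel_supp : closure [set x | K x != 0] `<=` `[- (1 / 2), 1 / 2] ;
  kernel_even : forall t, K t = K (- t) ;
  kernel_BV : exists g, weak_deriv (absz (q + 1)) K g /\ BV g ;
  kernel_mass : \int[mu]_t K t = 1 ;
  kernel_moments : forall r : nat, (0 < r <= p)%N ->
    \int[mu]_t (K t * t ^+ r) = 0 }.

Definition scaled_kernel (K : R -> R) (tau t : R) : R := tau^-1 * K (t / tau).

Definition micro_solution (H : R -> R -> 'M[R]_3) (eps tau ta : R)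
    (M : 'cV[R]_3) (m : R -> 'cV[R]_3) : Prop :=
  let I := [set` `[ta - tau / 2, ta + tau / 2]] in
  m ta = M /\
  forall t : R, I t -> is_deriv_in I m t (- (H t (t / eps) *m m t)).

(* F is the upscaled flux at (ta, M); the exact micro solution is unique on
   [ta - tau/2, ta + tau/2], so this determines F. *)
Definition is_upscaled_flux (H : R -> R -> 'M[R]_3) (K : R -> R)
    (eps tau ta : R) (M F : 'cV[R]_3) : Prop :=
  let I := [set` `[ta - tau / 2, ta + tau / 2]] in
  exists2 m, micro_solution H eps tau ta M m &
    F = \col_i \int[mu]_(s in I)
          (scaled_kernel K tau (s - ta) * deriv_in I m s i 0).

Definition midpoint (x : nat -> 'cV[R]_3) (n : nat) : 'cV[R]_3 :=
  2^-1 *: (x n + x n.+1).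

Definition grid (dt : R) (n : nat) : R := n%:R * dt.

Definition grid_mid (dt : R) (n : nat) : R := (grid dt n + grid dt n.+1) / 2.

End definitions.

(* Main.v *)
(* Skewness of the averaged field makes the midpoint rule an energy estimate:
   for e_n = M_n - mbar_n, pairing the difference of the two schemes with
   e_n + e_(n+1) gives |e_(n+1)| <= |e_n| + dt |r_n|, where
   r_n = F(t_(n+1/2), M_(n+1/2)) + avg_field H t_(n+1/2) M_(n+1/2) is the
   consistency error, and T <= sqrt T * exp (3 T / 4) absorbs the factor T.

   Consistency.  The micro solution conserves its norm, so on the window of size
   tau its derivative is - H(t_a, s / eps) M + O(tau |M|).  What remains is
   int K(u) h(a + (tau / eps) u) du - int_0^1 h for the 1-periodic entries
   h = H(t_a, .).  Replace h - int_0^1 h by the (q+2)-nd derivative of a periodic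
   function P and move the derivatives onto K: each primitive gains a factor
   eps / tau, primitives of zero mean stay bounded by sup |h|, and the last
   derivative is paid for by the total variation of K^(q+1).  Since h is smooth
   only inside the period cell, P is not an admissible test function; h is
   first approximated uniformly by smooth periodic functions, namely by cutting
   off h - h(0) near the integers, where it vanishes. *)
Require Import Defs.
From mathcomp Require Import all_boot all_order all_algebra.
From mathcomp Require Import all_classical all_reals all_analysis.
From mathcomp Require Import measurable_realfun ring lra.
Import Order.TTheory GRing.Theory Num.Theory.
Import numFieldNormedType.Exports.
Local Open Scope classical_set_scope.
Local Open Scope ring_scope.

Set Implicit Arguments.
Unset Strict Implicit.
Unset Printing Implicit Defensive.

(** * Smooth functions on the line *)

Section SmoothFunctions.
Context {R : realType}.
Implicit Types (f g : R -> R) (n : nat).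

(** The derivative is an existential witness rather than [derive1 f], so that closure proofs can
    supply it in closed form; any witness agrees with [derive1 f]. *)
Fixpoint diffn n f : Prop :=
  if n is m.+1 then
    exists2 f' : R -> R, (forall x : R, is_derive x 1 f (f' x)) & diffn m f'
  else True.

Definition smooth f := forall n, diffn n f.

Lemma diffnW n f : diffn n.+1 f -> diffn n f.
Proof.
by elim: n f => [//|n IH] f [f' df /IH sf']; exists f'.
Qed.

Lemma is_derive_derive1 f f' :
  (forall x : R, is_derive x 1 f (f' x)) -> derive1 f = f'.
Proof. by move=> df; apply/funext => x; rewrite derive1E derive_val. Qed.

Lemma is_derive_continuous f f' :
  (forall x : R, is_derive x 1 f (f' x)) -> continuous f.
Proof.
by move=> df x; apply/differentiable_continuous/derivable1_diffP; case: (df x).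
Qed.

Lemma smooth_derive f f' :
  smooth f -> (forall x : R, is_derive x 1 f (f' x)) -> smooth f'.
Proof.
move=> sf df n; have [g dg sg] := sf n.+1.
by rewrite -(is_derive_derive1 df) (is_derive_derive1 dg).
Qed.

Lemma smooth_is_derive f : smooth f ->
  forall x : R, is_derive x 1 f (derive1 f x).
Proof. by move=> sf; have [g dg _] := sf 1%N;
  rewrite (is_derive_derive1 dg). Qed.

Lemma smooth_derive1 f : smooth f -> smooth (derive1 f).
Proof. by move=> sf; apply: (smooth_derive sf); exact: smooth_is_derive. Qed.

Lemma smooth_continuous f : smooth f -> continuous f.
Proof. by move/smooth_is_derive/is_derive_continuous. Qed.

Lemma smooth_derive1n n f : smooth f -> smooth (derive1n n f).
Proof. by move=> sf; elim: n => // n IH; rewrite derive1nS;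
  apply: smooth_derive1. Qed.

Lemma diffn_cst n (c : R) : diffn n (cst c).
Proof.
elim: n c => [//|n IH] c; exists (cst 0) => [x|]; last exact: IH.
exact: is_derive_cst.
Qed.

Lemma diffnD n f g : diffn n f -> diffn n g -> diffn n (fun x => f x + g x).
Proof.
elim: n f g => [//|n IH] f g [f' df sf] [g' dg sg].
by exists (fun x => f' x + g' x); [move=> x; exact: is_deriveD|exact: IH].
Qed.

Lemma diffnM n f g : diffn n f -> diffn n g -> diffn n (fun x => f x * g x).
Proof.
elim: n f g => [//|n IH] f g sf0 sg0; have sf1 := diffnW sf0.
have sg1 := diffnW sg0; case: sf0 sg0 => [f' df sf] [g' dg sg].
exists (fun x => f x * g' x + g x * f' x); first by move=> x; exact: is_deriveM.
by apply: diffnD; apply: IH.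
Qed.

Lemma is_derive_affine (a b x : R) : is_derive x 1 (fun y : R => a + b * y) b.
Proof.
have := is_deriveD (is_derive_cst a x 1) (is_deriveZ b (is_derive_id x (1:R))).
by rewrite add0r /GRing.scale /= mulr1.
Qed.

Lemma continuous_affine f (a b : R) :
  continuous f -> continuous (fun x : R => f (a + b * x)).
Proof.
move=> cf x; apply: (@continuous_comp _ _ _ (fun u : R => a + b * u)) (cf _).
exact: (is_derive_continuous (is_derive_affine a b)).
Qed.

Lemma diffn_affine n f (a b : R) : diffn n f ->
  diffn n (fun x => f (a + b * x)).
Proof.
elim: n f => [//|n IH] f [f' df sf].
exists (fun x => f' (a + b * x) * b) => [x|]; last first.
  by apply: diffnM; [exact: IH|exact: diffn_cst].
have dab := is_derive_affine a b x;
  exact: (@is_derive1_comp _ f (fun y => a + b * y)).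
Qed.

(** The derivative - f' / f^2 contains 1/f again, to which the induction hypothesis applies one
    order lower. *)
Lemma diffnV n f : (forall x, f x != 0) -> diffn n f ->
  diffn n (fun x => (f x)^-1).
Proof.
move=> f0; elim: n => [//|n IH] sf0; have sf1 := diffnW sf0.
case: sf0 => f' df sf.
exists (fun x => -1 * ((f x)^-1 * (f x)^-1) * f' x).
  move=> x; apply: (is_derive_eq (is_deriveV (f0 x) (df x))).
  by rewrite /GRing.scale /= mulN1r -invfM -expr2.
by repeat apply: diffnM => //; try exact: diffn_cst; apply: IH.
Qed.

Lemma smooth_cst (c : R) : smooth (cst c).
Proof. by move=> n; exact: diffn_cst. Qed.

Lemma smoothD f g : smooth f -> smooth g -> smooth (fun x => f x + g x).
Proof. by move=> sf sg n; apply: diffnD. Qed.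

Lemma smoothM f g : smooth f -> smooth g -> smooth (fun x => f x * g x).
Proof. by move=> sf sg n; apply: diffnM. Qed.

Lemma smooth_affine f (a b : R) : smooth f -> smooth (fun x => f (a + b * x)).
Proof. by move=> sf n; apply: diffn_affine. Qed.

Lemma smoothV f : (forall x, f x != 0) -> smooth f ->
  smooth (fun x => (f x)^-1).
Proof. by move=> f0 sf n; apply: diffnV. Qed.

(* The powers of x^-1 make this family of flat functions stable under
   differentiation. *)
Definition flat k (x : R) : R :=
  if 0 < x then x^-1 ^+ k * expR (- x^-1) else 0.

(** With y = 1/x, exp y dominates its Taylor term y^(k+2) / (k+2)!. A quadratic bound makes the
    slope [flat k z / z] tend to 0 at the origin, the only delicate point for differentiability. *)
Lemma flat_bound k (x : R) : `|flat k x| <= (k.+2)`!%:R * x ^+ 2.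
Proof.
rewrite /flat; case: ifPn => [x0|_]; last first.
  by rewrite normr0 mulr_ge0// sqr_ge0.
have y0 : 0 < x^-1 by rewrite invr_gt0.
rewrite ger0_norm; last by rewrite mulr_ge0 ?expR_ge0// exprn_ge0// ltW.
rewrite expRN.
rewrite ler_pdivrMr ?expR_gt0//.
have /(le_trans _) : x^-1 ^+ k.+2 / (k.+2)`!%:R <= expR x^-1.
  by apply: le_trans (expR_ge1Dxn k.+1 (ltW y0)); rewrite lerDr.
have c0 : 0 < (k.+2)`!%:R :> R by rewrite ltr0n fact_gt0.
move: ((k.+2)`!%:R) c0 => c c0.
have -> : x^-1 ^+ k = (c * x ^+ 2) * (x^-1 ^+ k.+2 / c).
  by rewrite !exprS; field; rewrite !gt_eqF.
by move=> H; rewrite ler_pM2l ?H// mulr_gt0 ?exprn_gt0.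
Qed.

Lemma is_derive_flat k (x : R) :
  is_derive x 1 (flat k) (- k%:R * flat k.+1 x + flat k.+2 x).
Proof.
have [->|x_neq0] := eqVneq x 0.
  have f0 j : flat j 0 = 0 by rewrite /flat ltxx.
  rewrite !f0 mulr0 addr0; apply/is_derive1_caratheodory.
  exists (fun z => flat k z / z); split.
  + move=> z; rewrite f0 !subr0; have [->|z0] := eqVneq z 0;
    first by rewrite f0 mulr0.
    by rewrite mulfVK.
  + suff : flat k z / z @[z --> (0 : R)] --> (0 : R).
      by rewrite /prop_for /continuous_at f0 mul0r.
    apply/cvgr0Pnorm_le => e e0; near=> z.
    have [->|z0] := eqVneq z 0; first by rewrite invr0 mulr0 normr0 ltW.
    rewrite normrM normfV ler_pdivrMr ?normr_gt0//.
    apply: (le_trans (flat_bound _ _)); rewrite -real_normK ?num_real//.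
    rewrite expr2 mulrA ler_pM2r ?normr_gt0//.
    rewrite mulrC -ler_pdivlMr ?ltr0n ?fact_gt0//.
    near: z; apply: (@nbhs0_le R R^o); rewrite divr_gt0// ltr0n fact_gt0.
  + by rewrite f0 mul0r.
have [x0|x0] : x < 0 \/ 0 < x by apply/orP; rewrite -neq_lt.
- apply: (@near_eq_is_derive _ _ _ (cst 0)).
    near=> y; rewrite /flat /= ifF//. apply/negbTE; rewrite -leNgt ltW//.
    near: y; exact: lt_nbhsl.
  rewrite /flat (ltNge 0 x) (ltW x0) /= mulr0 addr0; exact: is_derive_cst.
- apply: (@near_eq_is_derive _ _ _ (fun y : R => y^-1 ^+ k * expR (- y^-1))).
    near=> y; rewrite /flat /= ifT//.
    near: y; exact: lt_nbhsr.
  have dV := is_deriveV (lt0r_neq0 x0) (is_derive_id x (1:R)).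
  have dE := @is_derive1_comp _ expR _ x _ _ (is_derive_expR _) (is_deriveN dV).
  have := is_deriveM (is_deriveX k dV) dE.
  rewrite (_ : _ * _ = fun y : R => y^-1 ^+ k * expR (- y^-1)); last first.
    by apply/funext => y; rewrite !fctE.
  move=> H; apply: (is_derive_eq H).
  rewrite /flat x0 /GRing.scale /= !mulr1 !fctE -exprVn /comp /=.
  move: (x^-1) => y {H dV dE}.
  by case: k => [|k] /=; rewrite ?exprS /=; ring.
Unshelve. all: by end_near. Qed.

Lemma smooth_flat k : smooth (flat k).
Proof.
move=> n; elim: n k => [//|n IH] k.
exists (fun x => - k%:R * flat k.+1 x + flat k.+2 x).
  by move=> x; exact: is_derive_flat.
by apply: diffnD => //; apply: diffnM => //; exact: diffn_cst.
Qed.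

Lemma flat_gt0 (x : R) : 0 < x -> 0 < flat 0 x.
Proof. by move=> x0; rewrite /flat x0 expr0 mul1r expR_gt0. Qed.

Lemma flat_ge0 (x : R) : 0 <= flat 0 x.
Proof. by rewrite /flat; case: ifP => // _; rewrite expr0 mul1r expR_ge0. Qed.

Lemma flat_le0 (x : R) : x <= 0 -> flat 0 x = 0.
Proof. by move=> x0; rewrite /flat ltNge x0. Qed.

(** The classical smooth transition from 0 on x <= 0 to 1 on x >= 1; the denominator is positive
    because x and 1 - x are never both nonpositive. *)
Definition smooth_step (x : R) : R := flat 0 x / (flat 0 x + flat 0 (1 - x)).

Lemma smooth_step_den (x : R) : 0 < flat 0 x + flat 0 (1 - x).
Proof.
have [x0|x0] := ltP 0 x; first by rewrite ltr_wpDr ?flat_ge0// flat_gt0.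
by rewrite ltr_wpDl ?flat_ge0// flat_gt0//; lra.
Qed.

Lemma smooth_stepP : smooth smooth_step.
Proof.
apply: smoothM; first exact: smooth_flat.
apply: smoothV => [x|]; first by rewrite gt_eqF ?smooth_step_den.
apply: smoothD; first exact: smooth_flat.
under eq_fun do rewrite -mulN1r.
by apply: smooth_affine; exact: smooth_flat.
Qed.

Lemma smooth_step0 (x : R) : x <= 0 -> smooth_step x = 0.
Proof. by move=> x0; rewrite /smooth_step flat_le0// mul0r. Qed.

Lemma smooth_step1 (x : R) : 1 <= x -> smooth_step x = 1.
Proof.
move=> x1; rewrite /smooth_step (@flat_le0 (1 - x)) ?addr0; last by lra.
by rewrite divff// gt_eqF// flat_gt0//; lra.
Qed.

Lemma smooth_step_itv (x : R) : 0 <= smooth_step x <= 1.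
Proof.
rewrite /smooth_step divr_ge0 ?flat_ge0//=;
  last by rewrite ltW ?smooth_step_den.
by rewrite ler_pdivrMr ?smooth_step_den// mul1r lerDl flat_ge0.
Qed.

(** Derivatives are local. This lets a cutoff that equals 1 on U be dropped before
    differentiating. *)
Lemma derive1n_eq_open (U : set R) n f g : open U -> {in U, f =1 g} ->
  {in U, derive1n n f =1 derive1n n g}.
Proof.
move=> oU; elim: n f g => [//|n IH] f g fg; rewrite !derive1Sn.
apply: IH => x xU; rewrite !derive1E; apply: near_eq_derive.
near=> y; apply: fg; near: y; move: xU; rewrite inE => xU.
by move: (open_nbhs_nbhs (conj oU xU)); apply: filterS => y; rewrite inE.
Unshelve. all: by end_near. Qed.

End SmoothFunctions.

(** * Periodic functions and their primitives *)

Section Periodic.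
Context {R : realType}.
Local Notation mu := (@lebesgue_measure R).
Implicit Types (f g : R -> R) (n : nat).

Definition periodic1 f := forall x, f (x + 1) = f x.

Lemma periodic1_int f : periodic1 f -> forall x (m : int), f (x + m%:~R) = f x.
Proof.
move=> pf x; have pn y n : f (y + n%:R) = f y.
  elim: n => [|n IH]; first by rewrite addr0.
  by rewrite -natr1 addrA pf.
case=> n; first by rewrite -pmulrn pn.
by rewrite NegzE mulrNz -pmulrn -(pn _ n.+1) subrK.
Qed.

Definition fract (x : R) : R := x - (Num.floor x)%:~R.

Lemma fract_itv (x : R) : 0 <= fract x < 1.
Proof.
have /andP[h1 h2] := floor_itv x; rewrite intrD in h2.
by rewrite /fract; lra.
Qed.

Lemma fractD1 (x : R) : fract (x + 1) = fract x.
Proof. by rewrite /fract floorDrz ?rpred1// floor1 intrD; ring. Qed.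

Lemma periodic1_fract f x : periodic1 f -> f (fract x) = f x.
Proof. by move=> pf; rewrite /fract -mulrNz periodic1_int. Qed.

(** Every point has such a neighbourhood, with k its floor ([floor_nbhs]), so local statements on
    [fract] reduce to two translations. *)
Lemma fract_local (x : R) (k : int) : k%:~R - 1 < x < k%:~R + 1 ->
  (k%:~R <= x /\ fract x = x - k%:~R) \/ (x < k%:~R /\ fract x = x - k%:~R + 1).
Proof.
move=> /andP[h1 h2]; have [kx|xk] := leP k%:~R x; [left|right]; split => //.
  rewrite /fract (@floor_def _ _ k)//; first by rewrite kx intrD.
rewrite /fract (@floor_def _ _ (k - 1)) ?intrB; first by ring.
by lra.
Qed.

Lemma floor_nbhs (x : R) : \forall y \near x,
  (Num.floor x)%:~R - 1 < y < (Num.floor x)%:~R + 1.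
Proof.
have /andP[h1 h2] := floor_itv x; rewrite intrD in h2.
near=> y; apply/andP; split; near: y.
- by apply: lt_nbhsr; lra.
- by apply: lt_nbhsl; lra.
Unshelve. all: by end_near. Qed.

Lemma is_derive_shift1 f (df : R) (a x : R) :
  is_derive (x + a) 1 f df -> is_derive x 1 (fun y => f (y + a)) df.
Proof.
move=> dfx; have := @is_derive1_comp _ f (shift a) x df 1 dfx.
by rewrite mulr1; apply; exact: is_derive_shift.
Qed.

Definition vanish (d : R) f := forall x, x < d \/ 1 - d < x -> f x = 0.

(** Near x the periodization is the sum of two translates of f, since on each branch of [fract] the
    other translate has its argument outside [d, 1 - d]. No jump can occur at the integers. *)
Lemma is_derive_fract f f' d : 0 < d -> vanish d f -> vanish d f' ->
  (forall x : R, is_derive x 1 f (f' x)) ->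
  forall x : R, is_derive x 1 (f \o fract) (f' (fract x)).
Proof.
move=> d0 vf vf' df x; have := floor_nbhs x; set k := Num.floor x => nx.
pose loc g y := g (y - k%:~R) + g (y - k%:~R + 1).
have locE g y : vanish d g -> k%:~R - 1 < y < k%:~R + 1 ->
  loc g y = g (fract y).
  move=> vg /fract_local[] [ky ->]; rewrite /loc.
    by rewrite [X in _ + X]vg ?addr0//; right; lra.
  by rewrite [X in X + _]vg ?add0r//; left; lra.
rewrite -(locE f' x vf' (nbhs_singleton nx)).
apply: (@near_eq_is_derive _ _ _ (loc f)).
  by apply: filterS nx => y; apply: locE.
apply: is_deriveD; first exact: is_derive_shift1.
under eq_fun do rewrite -addrA.
by rewrite -addrA; exact: is_derive_shift1.
Qed.

Lemma derive_vanish f d : vanish d f -> vanish d (derive1 f).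
Proof.
move=> vf x hx; rewrite derive1E (@near_eq_derive _ _ _ _ (cst 0))
  ?derive_cst//.
case: hx => hx; near=> y; apply: vf; [left|right]; near: y.
- exact: lt_nbhsl.
- exact: lt_nbhsr.
Unshelve. all: by end_near. Qed.

Lemma smooth_fract f d : 0 < d -> vanish d f -> smooth f -> smooth (f \o fract).
Proof.
move=> d0 vf sf n; elim: n f vf sf => [//|n IH] f vf sf.
exists (derive1 f \o fract); last first.
  by apply: IH; [exact: derive_vanish|exact: smooth_derive1].
move=> x; apply: (is_derive_fract d0 vf); first exact: derive_vanish.
exact: smooth_is_derive.
Qed.

End Periodic.

(** * Iterated antiderivatives of periodic functions of zero mean *)

Section Antiderivative.
Context {R : realType}.
Local Notation mu := (@lebesgue_measure R).
Implicit Types (f g : R -> R) (n : nat).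

Lemma continuous_itv_integrable f (a b : R) :
  continuous f -> mu.-integrable `[a, b] (EFin \o f).
Proof.
move=> cf; apply: continuous_compact_integrable; first exact: segment_compact.
exact: continuous_subspaceT.
Qed.

Definition mean f : R := \int[mu]_(t in `[0, 1]) f t.

Lemma mean_cst (c : R) : mean (cst c) = c.
Proof.
rewrite /mean Rintegral_cst//= lebesgue_measure_itv /= lte_fin ltr01.
by rewrite oppr0 adde0 mulr1.
Qed.

Lemma meanB f (c : R) : continuous f -> mean (fun x => f x - c) = mean f - c.
Proof.
move=> cf; rewrite /mean RintegralB//; last 2 first.
- exact: continuous_itv_integrable.
- by apply: (@continuous_itv_integrable (cst c)) => x; exact: cvg_cst.
by rewrite -/(mean f) -/(mean (cst c)) mean_cst.
Qed.

(** Zero mean is what makes an antiderivative periodic; normalizing that antiderivative to zero mean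
    again allows iteration. *)
Definition balanced f := [/\ continuous f, periodic1 f & mean f = 0].

Lemma balanced_antiderivative f : balanced f ->
  exists2 F, balanced F & forall x : R, is_derive x 1 F (f x).
Proof.
(* Starting at -1 keeps 0 in the interior of the range where the fundamental theorem of calculus
   applies. *)
move=> [cf pf mf]; pose Phi (x : R) := \int[mu]_(t in `[-1, x]) f t.
have dPhi (x : R) : -1 < x -> is_derive x 1 Phi (f x).
  move=> x1; have xx1 : x < x + 1 by rewrite ltrDl.
  have [d e] := @continuous_FTC1_closed R f (-1) x (x + 1)
    xx1 (continuous_itv_integrable _ _ cf) x1 (cf x).
  by apply: DeriveDef => //; rewrite -derive1E.
(* The increment over one period has derivative 0 by periodicity of f, and at 0 it is the mean of f,
   hence zero. *)
have Phi1 (x : R) : -1 < x -> Phi (x + 1) = Phi x.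
  pose D (y : R) := Phi (y + 1) - Phi y.
  have dD (y : R) : -1 < y -> is_derive y 1 D 0.
    move=> y1; rewrite -[0](subrr (f y)) -{1}(pf y); apply: is_deriveB.
      by apply: is_derive_shift1; apply: dPhi; lra.
    exact: dPhi.
  have D0 : D 0 = 0.
    rewrite /D add0r /Phi Rintegral_itvB ?bnd_simp//.
    - rewrite Rintegral_itv_obnd_cbnd//; last first.
        apply: integrableS (continuous_itv_integrable 0 1 cf) => //.
        exact: subset_itv_oc_cc.
    - exact: continuous_itv_integrable.
  have Dc (y z : R) : -1 < y -> y < z -> D y = D z.
    move=> y1 yz; have [||c _] := @MVT _ D (cst 0) y z yz.
    - by move=> u; rewrite in_itv/= => /andP[yu _]; apply: dD; lra.
    - apply: continuous_in_subspaceT => u;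
      rewrite inE/= in_itv/= => /andP[yu _].
      have u1 : -1 < u by lra.
      by apply/differentiable_continuous/derivable1_diffP; case: (dD u u1).
    by rewrite /cst mul0r => /eqP; rewrite subr_eq0 => /eqP.
  move=> x1; apply/eqP; rewrite -subr_eq0 -/(D x); apply/eqP; rewrite -D0.
  have [x0|x0|->//] := ltgtP x 0; first exact: Dc.
  by symmetry; apply: Dc => //; lra.
(* Left of -1 the interval of integration is empty and [Phi] is 0, so only its values on [0, 1) are
   kept and repeated periodically. *)
pose F0 := Phi \o @fract R.
have dF0 (x : R) : is_derive x 1 F0 (f x).
  have := floor_nbhs x; set k := Num.floor x => nx.
  (* The shift by 1 - k carries ]k - 1, k + 1[ into ]0, 2[, where [dPhi] and [Phi1] are both
     available. *)
  rewrite -(periodic1_int pf x (- k + 1)).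
  apply: (@near_eq_is_derive _ _ _ (fun y : R => Phi (y + (- k + 1)%:~R))).
    apply: filterS nx => y /fract_local[] [ky yE]; rewrite /F0 /= yE.
      by rewrite intrD intrN addrA Phi1//; lra.
    by rewrite intrD intrN addrA.
  apply: is_derive_shift1; apply: dPhi; rewrite intrD intrN.
  by have /andP[] := nbhs_singleton nx; lra.
have cF0 : continuous F0 := is_derive_continuous dF0.
exists (fun x => F0 x - mean F0).
  split; last by rewrite meanB// subrr.
    by move=> x; apply: cvgB; [exact: cF0|exact: cvg_cst].
  by move=> x; rewrite /F0 /= fractD1.
by move=> x; rewrite -[f x]subr0; apply: is_deriveB; exact: is_derive_cst.
Qed.

Lemma balanced_primitives f : balanced f ->
  exists P : nat -> R -> R, [/\ P 0%N = f, forall k, balanced (P k) &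
    forall k (x : R), is_derive x 1 (P k.+1) (P k x)].
Proof.
move=> bf.
(* Choice needs a total map; functions that are not balanced are sent to themselves. *)
have /choice[A HA] : forall g, exists G, balanced g ->
    balanced G /\ forall x : R, is_derive x 1 G (g x).
  move=> g; have [bg|nbg] := pselect (balanced g); last by exists g.
  by have [G bG dG] := balanced_antiderivative bg; exists G.
have bA k : balanced (iter k A f) by elim: k => //= k /HA[].
exists (fun k => iter k A f); split=> // k x.
by have [_ dG] := HA _ (bA k); exact: dG.
Qed.

(* Rolle applied to F, over one period, gives a zero of f. *)
Lemma balanced_primitive_le (F f g : R -> R) (c : R) : periodic1 F ->
  (forall x : R, is_derive x 1 F (f x)) ->
  (forall x : R, is_derive x 1 f (g x)) ->
  (forall x, `|g x| <= c) -> forall x, `|f x| <= c.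
Proof.
move=> pF dF df gc x; have x1 : x < x + 1 by rewrite ltrDl.
have [||z zx dz] := @Rolle _ F x (x + 1) x1 _ _ (esym (pF x)).
- by move=> y _; case: (dF y).
- exact/continuous_subspaceT/(is_derive_continuous dF).
have fz : f z = 0 by case: (dF z) dz => _ <- [].
move: zx; rewrite in_itv/= => /andP[xz zx].
have [w _] := MVT xz (fun y _ => df y)
  (continuous_subspaceT (is_derive_continuous df)).
rewrite fz sub0r => fE; rewrite -normrN fE normrM.
rewrite -[c]mulr1 ler_pM// ger0_norm; lra.
Qed.

Lemma diffn_primitives (P : nat -> R -> R) k n :
  (forall k (x : R), is_derive x 1 (P k.+1) (P k x)) ->
  smooth (P 0%N) -> diffn n (P k).
Proof.
move=> dP s0; elim: k n => [n|k IH [//|n]]; first exact: s0.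
by exists (P k).
Qed.

End Antiderivative.

(** * Oscillatory integrals against the kernel *)

Section SmoothKernel.
Context {R : realType}.
Local Notation mu := (@lebesgue_measure R).
Implicit Types (f g : R -> R) (n : nat).

(** Equal to 1 on an open neighbourhood of [-1/2, 1/2], which contains the support of K, and 0
    outside [-1, 1]. *)
Definition cutoff (u : R) : R :=
  smooth_step (4 + 4 * u) * smooth_step (4 + - 4 * u).

Lemma smooth_cutoff : smooth cutoff.
Proof. by apply: smoothM; apply: smooth_affine; exact: smooth_stepP. Qed.

Lemma cutoff1 u : - (3 / 4) < u < 3 / 4 -> cutoff u = 1.
Proof. by move=> h; rewrite /cutoff !smooth_step1 ?mulr1//; lra. Qed.

Lemma cutoff0 u : ~~ (-1 <= u <= 1) -> cutoff u = 0.
Proof.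
rewrite negb_and -!ltNge => /orP[h|h]; rewrite /cutoff.
  by rewrite smooth_step0 ?mul0r//; lra.
by rewrite (@smooth_step0 _ (4 + - 4 * u)) ?mulr0//; lra.
Qed.

Lemma cutoff_itv u : 0 <= cutoff u <= 1.
Proof.
have /andP[a0 a1] := smooth_step_itv (4 + 4 * u).
have /andP[b0 b1] := smooth_step_itv (4 + - 4 * u).
by rewrite /cutoff mulr_ge0//= mulr_ile1.
Qed.

Lemma compactly_supportedP f (a b : R) :
  (forall x, ~~ (a <= x <= b) -> f x = 0) -> compactly_supported f.
Proof.
move=> f0; apply: (@subclosed_compact _ _ `[a, b]).
- exact: closed_closure.
- exact: segment_compact.
- have /closure_id -> : closed `[a, b] by exact: interval_closed.
  apply: closureS => x /= /eqP fx; rewrite in_itv/=.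
  by apply: contra_notT fx => /f0.
Qed.

Lemma derive_outside f (a b : R) : (forall x, ~~ (a <= x <= b) -> f x = 0) ->
  forall x, ~~ (a <= x <= b) -> derive1 f x = 0.
Proof.
move=> f0 x; rewrite derive1E negb_and -!ltNge => /orP[h|h];
  rewrite (@near_eq_derive _ _ _ _ (cst 0)) ?derive_cst//; near=> y;
  apply: f0; rewrite negb_and -!ltNge; apply/orP; [left|right]; near: y.
- exact: lt_nbhsl.
- exact: lt_nbhsr.
Unshelve. all: by end_near. Qed.

(** Each derivative lowers the index of P by one and brings out a factor b; with b = tau / eps this
    is the source of the powers of eps / tau. *)
Lemma derive1n_primitives (P : nat -> R -> R) k (c a b : R) :
  (forall k (x : R), is_derive x 1 (P k.+1) (P k x)) ->
  derive1n k (fun u => c * P k (a + b * u)) =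
  fun u => c * b ^+ k * P 0%N (a + b * u).
Proof.
move=> dP; elim: k c => [|k IH] c; first by rewrite expr0 mulr1.
rewrite derive1Sn (_ : derive1 _ = fun u => c * b * P k (a + b * u)).
  by rewrite IH; apply/funext => u; rewrite exprS mulrA.
apply: is_derive_derive1 => u; rewrite -mulrA.
have dab := is_derive_affine a b u.
apply: (@is_deriveZ _ _ _ _ c).
by rewrite mulrC; exact: (@is_derive1_comp _ (P k.+1) (fun y => a + b * y)).
Qed.

Lemma mean_le f (c : R) : continuous f -> (forall x, `|f x| <= c) ->
  `|mean f| <= c.
Proof.
move=> cf fc; rewrite /mean.
have mf := continuous_itv_integrable 0 1 cf.
apply: (le_trans (le_normr_Rintegral _ mf)) => //.
rewrite -[leRHS](mean_cst c) /mean; apply: le_Rintegral => //.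
- by apply: (@continuous_itv_integrable _ (fun x => `|f x|)) => x;
  apply: cvg_norm; exact: cf.
- by apply: (@continuous_itv_integrable _ (cst c)) => x; exact: cvg_cst.
Qed.

Lemma integrable_bounded_mul (D : set R) f g (c : R) : measurable D ->
  mu.-integrable D (EFin \o f) ->
  measurable_fun D g -> (forall x, D x -> `|g x| <= c) ->
  mu.-integrable D (EFin \o (fun x => f x * g x)).
Proof.
move=> mD fi mg gc; have -> :
  EFin \o (fun x => f x * g x) = ((EFin \o f) \* (EFin \o g))%E.
  by apply/funext => x /=; rewrite EFinM.
apply: integrableMl => //; exists c; split; first exact: num_real.
by move=> d cd x Dx; apply: (le_trans (gc _ Dx)); exact: ltW.
Qed.

(** On the support of K, h - mean h at a + b u is, up to constants, b^-(n+1) times the derivative of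
    order n + 1 of a test function psi. Moving n derivatives onto K leaves the integral of g psi',
    which the variation bound V controls once |psi| <= 1. *)
Lemma kernel_smooth_le (n : nat) (K g : R -> R) (V : R) :
  mu.-integrable setT (EFin \o K) -> \int[mu]_t K t = 1 ->
  (forall u : R, ~~ (- (1 / 2) <= u <= 1 / 2) -> K u = 0) ->
  weak_deriv n K g ->
  (forall phi : R -> R, (forall x, derivable phi x 1) ->
     continuous (derive1 phi) -> compactly_supported phi ->
     (forall x, `|phi x| <= 1) -> \int[mu]_x (g x * derive1 phi x) <= V) ->
  forall (h : R -> R) (c a b : R), smooth h -> periodic1 h -> 0 < c ->
    (forall x, `|h x| <= c) -> 0 < b ->
  `|\int[mu]_u (K u * h (a + b * u)) - mean h| <= 2 * c * V / b ^+ n.+1.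
Proof.
move=> iK K1 K0 [_ _ wK] bvg h c a b sh ph c0 hc b0.
have ch := smooth_continuous sh.
have c20 : 0 < 2 * c by rewrite mulr_gt0.
pose h0 x := h x - mean h.
have sh0 : smooth h0 by apply: smoothD => //; exact: smooth_cst.
have ch0 := smooth_continuous sh0.
have bh0 : balanced h0 by split=> //; [move=> x;
  rewrite /h0 ph|rewrite meanB// subrr].
have h0c x : `|h0 x| <= 2 * c.
  by rewrite (le_trans (ler_normB _ _))// mulrDl mul1r lerD// mean_le.
have [P [P0 bP dP]] := balanced_primitives bh0.
(* All primitives keep the same bound: [P k.+1] has a zero in each period because it is the
   derivative of the periodic [P k.+2]. *)
have Pc k x : `|P k x| <= 2 * c.
  elim: k x => [|k IH]; first by rewrite P0.
  by apply: (@balanced_primitive_le _ (P k.+2) (P k.+1) (P k)) => //;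
    case: (bP k.+2).
pose J := \int[mu]_u (K u * h0 (a + b * u)).
have iJ f : continuous f -> (forall x, `|f x| <= 2 * c) ->
    mu.-integrable setT (EFin \o (fun u => K u * f (a + b * u))).
  move=> cf fc; apply: (@integrable_bounded_mul _ _ _ (2 * c)) => //.
  by apply: continuous_measurable_fun; exact: continuous_affine.
have -> : \int[mu]_u (K u * h (a + b * u)) - mean h = J.
  rewrite -[mean h]mulr1 -K1 -RintegralZl// -RintegralB//; last 2 first.
  - by apply: iJ => // x; rewrite (le_trans (hc x))//; lra.
  - exact: (integrableZl _ (mean h) iK).
  by apply: eq_Rintegral => x _; rewrite /h0; ring.
(* The variation bound is one-sided. Leaving the sign s free, s = 1 and s = -1 give both
   inequalities, whatever the sign of (-1)^n. *)
have key s : `|s| = 1 -> (-1) ^+ n * s * (b ^+ n.+1 * J) <= 2 * c * V.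
  (* Division by 2c gives |psi| <= 1, as the variation bound requires. *)
  move=> s1; pose k := s / (2 * c).
  pose psi u := cutoff u * (k * P n.+1 (a + b * u)).
  have spsi : smooth psi.
    apply: smoothM; first exact: smooth_cutoff.
    apply: smoothM; first exact: smooth_cst.
    by apply: smooth_affine => m; apply: diffn_primitives => //; rewrite P0.
  have psi0 x : ~~ (-1 <= x <= 1) -> psi x = 0.
    by move=> hx; rewrite /psi cutoff0// mul0r.
  (* The weak derivative of order n is tested against psi', not psi: one derivative must remain for
     the variation of g. *)
  have tpsi : test_function (derive1 psi).
    split; last by apply: (@compactly_supportedP _ (-1) 1);
      exact: derive_outside.
    move=> m x; rewrite -derive1Sn.
    by case: (smooth_is_derive (smooth_derive1n m.+1 spsi) x).
  have := wK _ tpsi; rewrite -derive1Sn => wE.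
  have : \int[mu]_x (K x * derive1n n.+1 psi x) = k * b ^+ n.+1 * J.
    rewrite -RintegralZl//; last by apply: iJ.
    apply: eq_Rintegral => x _.
    have [hx|hx] := boolP (- (1 / 2) <= x <= 1 / 2); last first.
      by rewrite K0// !mul0r mulr0.
    rewrite (@derive1n_eq_open _ `]- (3 / 4), 3 / 4[ _ _
      (fun u => k * P n.+1 (a + b * u))).
    - by rewrite derive1n_primitives// P0; ring.
    - exact: interval_open.
    - by move=> u; rewrite inE/= in_itv/= => hu; rewrite /psi cutoff1 ?mul1r.
    - by rewrite inE/= in_itv/=; lra.
  rewrite wE => {}wE.
  have : \int[mu]_x (g x * derive1 psi x) <= V.
    apply: bvg.
    - by move=> x; case: (smooth_is_derive spsi x).
    - exact/smooth_continuous/smooth_derive1.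
    - exact: compactly_supportedP psi0.
    - move=> x; have /andP[x0 x1] := cutoff_itv x.
      rewrite /psi normrM (ger0_norm x0) mulr_ile1// normrM /k normrM s1 mul1r.
      rewrite normfV (gtr0_norm c20).
      by rewrite mulrC ler_pdivrMr ?mul1r.
  move/(ler_wpM2l (ltW c20)).
  apply: le_trans; rewrite le_eqVlt; apply/orP; left; apply/eqP.
  have -> : \int[mu]_x (g x * derive1 psi x) = (-1) ^+ n * (k * b ^+ n.+1 * J).
    by rewrite -wE mulrA -expr2 sqrr_sign mul1r.
  by rewrite /k; field; rewrite gt_eqF.
rewrite ler_pdivlMr ?exprn_gt0// mulrC -[X in X * _]ger0_norm ?exprn_ge0 ?(ltW
  b0)//.
rewrite -normrM ler_norml; apply/andP; split.
  rewrite lerNl; have [e|e] := eqVneq ((-1) ^+ n) (1 : R).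
    have := key (-1); rewrite normrN1 e mul1r mulN1r; exact.
  have := key 1; rewrite normr1 mulr1.
  by move: e; rewrite -signr_odd; case: odd => //=;
    rewrite ?eqxx// expr1 mulN1r => _; apply.
have [e|e] := eqVneq ((-1) ^+ n) (1 : R).
  have := key 1; rewrite normr1 e !mul1r; exact.
have := key (-1); rewrite normrN1 => /(_ erefl).
by move: e; rewrite -signr_odd; case: odd => //=;
  rewrite ?eqxx// expr1 mulrNN !mul1r.
Qed.

End SmoothKernel.

(** * Calculus of derivatives relative to a set *)

Section RelativeDerivative.
Context {R : realType}.
Implicit Types (f : R -> R) (A : set R).

(** The remainder form avoids the quotient and includes y = x, which the punctured filter omits. *)
Lemma is_deriv_inP A f (x l : R) : is_deriv_in A f x l -> forall e, 0 < e ->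
  exists2 d, 0 < d & forall y, A y -> `|y - x| < d ->
    `|f y - f x - l * (y - x)| <= e * `|y - x|.
Proof.
move=> dfx e e0; have /cvgrPdist_le/(_ _ e0) : is_deriv_in A f x l := dfx.
rewrite near_withinE near_withinE => /nbhs_ballP[d /= d0 H];
  exists d => // y Ay yx.
have [->|yx0] := eqVneq y x; first by rewrite !subrr mulr0 subr0 normr0 mulr0.
have := H y; rewrite /ball/= distrC => /(_ yx yx0 Ay).
have yx1 : y - x != 0 by rewrite subr_eq0.
rewrite /diff_quotient /GRing.scale /= => le.
have -> : f y - f x - l * (y - x) = - (l - (y - x)^-1 * (f y - f x)) * (y - x).
  by field.
by rewrite normrM normrN ler_wpM2r.
Qed.

(** At an interior point of A the restriction to A is invisible to the limit; the slope completed by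
    l at x is the Caratheodory function. *)
Lemma is_deriv_in_is_derive A f (x l : R) :
  nbhs x A -> is_deriv_in A f x l -> is_derive x 1 f l.
Proof.
move=> nA /is_deriv_inP dfx; apply/is_derive1_caratheodory.
exists (fun z => if z == x then l else (f z - f x) / (z - x)); split.
- move=> z; case: eqVneq => [->|zx]; first by rewrite !subrr mulr0.
  by rewrite divfK// subr_eq0.
- rewrite /prop_for /continuous_at eqxx; apply/cvgrPdist_le => e e0.
  have [d d0 H] := dfx _ e0; near=> z.
  case: eqVneq => [_|zx]; first by rewrite subrr normr0 ltW.
  have zx0 : z - x != 0 by rewrite subr_eq0.
  rewrite -(ler_pM2r (_ : 0 < `|z - x|)) ?normr_gt0// -normrM.
  rewrite mulrBl divfK// distrC; apply: H; first by near: z.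
  by near: z; apply/nbhs_ballP; exists d => //= z; rewrite /ball/= distrC.
- by rewrite eqxx.
Unshelve. all: by end_near. Qed.

Lemma is_deriv_in_cvg A f (x l : R) :
  is_deriv_in A f x l -> f y @[y --> within A (nbhs x)] --> f x.
Proof.
move=> df; have [d d0 H] := is_deriv_inP df ltr01.
apply/cvgrPdist_le => e e0; rewrite near_withinE.
have c0 : 0 < `|l| + 1 by rewrite ltr_wpDl.
apply/nbhs_ballP; exists (Num.min d (e / (`|l| + 1))) => /=.
  by rewrite lt_min d0 divr_gt0.
move=> y; rewrite /ball/= distrC lt_min => /andP[yd ye] Ay.
have : `|f x - f y| <= (`|l| + 1) * `|y - x|.
  rewrite distrC -[f y - f x](subrK (l * (y - x))) mulrDl mul1r addrC.
  rewrite (le_trans (ler_normD _ _))// normrM lerD2l -[leRHS]mul1r.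
  exact: H.
by move=> /le_trans; apply; rewrite mulrC -ler_pdivlMr// ltW.
Qed.

Lemma is_deriv_in_continuous A f f' :
  (forall x, A x -> is_deriv_in A f x (f' x)) -> {within A, continuous f}.
Proof.
move=> df; apply/subspace_continuousP => x Ax.
exact: is_deriv_in_cvg (df x Ax).
Qed.

Lemma is_deriv_in_eq A f g (x l : R) :
  A x -> (forall y, A y -> f y = g y) -> is_deriv_in A f x l ->
    is_deriv_in A g x l.
Proof.
move=> Ax fg df; apply: cvg_trans df; apply: near_eq_cvg.
rewrite near_withinE; apply: nearW => y Ay.
by rewrite /diff_quotient !fg.
Qed.

Lemma is_deriv_inD A f g (x l k : R) :
  is_deriv_in A f x l -> is_deriv_in A g x k ->
  is_deriv_in A (fun y => f y + g y) x (l + k).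
Proof.
move=> df dg; rewrite /is_deriv_in.
rewrite (_ : diff_quotient _ x = fun y => diff_quotient f x y + diff_quotient g
  x y).
  exact: cvgD df dg.
by apply/funext => y; rewrite /diff_quotient -scalerDr; congr (_ *: _); ring.
Qed.

Lemma is_deriv_inM A f g (x l k : R) :
  is_deriv_in A f x l -> is_deriv_in A g x k ->
  is_deriv_in A (fun y => f y * g y) x (l * g x + f x * k).
Proof.
move=> df dg; rewrite /is_deriv_in.
rewrite (_ : diff_quotient _ x = fun y =>
    diff_quotient f x y * g y + f x * diff_quotient g x y).
  apply: cvgD; last exact: cvgM (cvg_cst (f x)) dg.
  apply: cvgM; first exact: df.
  apply: cvg_trans (is_deriv_in_cvg dg) => P; apply: cvg_app => Q.
  by move=> /nbhs_ballP[d d0 dQ]; apply/nbhs_ballP; exists d => // y /dQ h _;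
    exact: h.
by apply/funext => y; rewrite /diff_quotient /GRing.scale /=; ring.
Qed.

End RelativeDerivative.

(** * The kernel estimate for functions smooth only inside the period cell *)

Section CellKernel.
Context {R : realType}.
Local Notation mu := (@lebesgue_measure R).
Implicit Types (f g : R -> R) (n : nat).

(** Where [chi] vanishes the product is locally zero, and elsewhere the point lies in ]0, 1[. The
    derivative chi e_(l+1) + chi' e_l is a sum of two products of the same kind, hence the induction
    over all [chi] and l. *)
Lemma diffn_vanish_mul (e : nat -> R -> R) (d : R) n chi l :
  0 < d -> vanish d chi -> smooth chi ->
  (forall l (s : R), 0 < s < 1 -> is_derive s 1 (e l) (e l.+1 s)) ->
  diffn n (fun s => chi s * e l s).
Proof.
move=> d0 + + de; elim: n chi l => [//|n IH] chi l vc sc.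
exists (fun s => chi s * e l.+1 s + derive1 chi s * e l s); last first.
  by apply: diffnD; apply: IH => //;
    [exact: derive_vanish|exact: smooth_derive1].
move=> s; have vc' := derive_vanish vc.
have [sd|ds] := ltP s d.
  apply: (@near_eq_is_derive _ _ _ (cst 0)).
    near=> y; rewrite vc ?mul0r//; left; near: y; exact: lt_nbhsl.
  by rewrite vc ?vc' ?mul0r ?addr0; [exact: is_derive_cst|left|left].
have [sd|ds'] := ltP (1 - d) s.
  apply: (@near_eq_is_derive _ _ _ (cst 0)).
    near=> y; rewrite vc ?mul0r//; right; near: y; exact: lt_nbhsr.
  by rewrite vc ?vc' ?mul0r ?addr0; [exact: is_derive_cst|right|right].
rewrite [X in _ + X]mulrC; apply: is_deriveM; first exact: smooth_is_derive.
by apply: de; lra.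
Unshelve. all: by end_near. Qed.

(** The arguments are (s - d)/d and (1 - d - s)/d, written in the affine form expected by
    [smooth_affine]. The value is 1 on [2d, 1 - 2d] and 0 outside [d, 1 - d]. *)
Definition cell_cutoff (d s : R) : R :=
  smooth_step (-1 + d^-1 * s) * smooth_step ((d^-1 - 1) + - d^-1 * s).

Lemma smooth_cell_cutoff d : smooth (cell_cutoff d).
Proof. by apply: smoothM; apply: smooth_affine; exact: smooth_stepP. Qed.

Lemma cell_cutoff_itv d s : 0 <= cell_cutoff d s <= 1.
Proof.
have /andP[a0 a1] := smooth_step_itv (-1 + d^-1 * s).
have /andP[b0 b1] := smooth_step_itv ((d^-1 - 1) + - d^-1 * s).
by rewrite /cell_cutoff mulr_ge0//= mulr_ile1.
Qed.

Lemma vanish_cell_cutoff d : 0 < d -> vanish d (cell_cutoff d).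
Proof.
move=> d0 s [h|h]; rewrite /cell_cutoff.
  rewrite smooth_step0 ?mul0r// addrC subr_le0 mulrC ler_pdivrMr// mul1r;
    exact: ltW.
rewrite (@smooth_step0 _ (_ + - d^-1 * s)) ?mulr0//.
have -> : d^-1 - 1 + - d^-1 * s = (1 - d - s) / d by field; rewrite gt_eqF.
by rewrite ler_pdivrMr// mul0r; lra.
Qed.

Lemma cell_cutoff1 d s : 0 < d -> 2 * d <= s <= 1 - 2 * d ->
  cell_cutoff d s = 1.
Proof.
move=> d0 h; rewrite /cell_cutoff !smooth_step1 ?mulr1//.
  have -> : d^-1 - 1 + - d^-1 * s = (1 - d - s) / d by field; rewrite gt_eqF.
  by rewrite ler_pdivlMr//; lra.
have -> : -1 + d^-1 * s = (s - d) / d by field; rewrite gt_eqF.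
by rewrite ler_pdivlMr//; lra.
Qed.

Section Cell.
Variables (h : R -> R) (d : nat -> R -> R) (c : R).
Hypotheses (ph : periodic1 h) (hc : forall x, `|h x| <= c).
Hypothesis d0h : forall s : R, 0 <= s <= 1 -> d 0%N s = h s.
Hypothesis dS : forall l (s : R), 0 <= s <= 1 ->
  is_deriv_in `[0, 1] (d l) s (d l.+1 s).

Let h0 x := h x - h 0.

Let h0c x : `|h0 x| <= 2 * c.
Proof. by rewrite (le_trans (ler_normB _ _))// mulrDl mul1r lerD. Qed.

(* The cutoffs vanish near the integers, so only h - h 0, which is small there,
   is approximated uniformly. *)
Lemma cell_approx (eta : R) : 0 < eta -> exists w, [/\ smooth w, periodic1 w,
  forall x, `|w x| <= 2 * c & forall x, `|w x - h0 x| <= eta].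
Proof.
move=> eta0.
pose e l s := if l is 0%N then d 0%N s - h 0 else d l s.
have de l (s : R) : 0 < s < 1 -> is_derive s 1 (e l) (e l.+1 s).
  move=> s01; have ds : is_derive s 1 (d l) (d l.+1 s).
    have s01' : 0 <= s <= 1 by lra.
    apply: (is_deriv_in_is_derive _ (@dS l s s01')).
    have : s \in `]0, 1[ by rewrite in_itv.
    move/near_in_itvoo; apply: filterS => y.
    by rewrite /= !in_itv/= => /andP[? ?]; rewrite !ltW.
  case: l ds => [|l]//= ds; rewrite -[d 1%N s]subr0.
  apply: is_deriveB; exact: is_derive_cst.
have h1 : h 1 = h 0 by rewrite -[1]add0r ph.
(* One-sided differentiability at an end of the cell bounds |h0 s| by M |s - s0| nearby, with M the
   absolute slope plus 1. *)
have nearpt s0 : 0 <= s0 <= 1 -> h s0 = h 0 ->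
    exists2 r, 0 < r & forall s, 0 <= s <= 1 -> `|s - s0| < r -> `|h0 s| <= eta.
  move=> s01 hs0; have [r r0 H] := is_deriv_inP (@dS 0%N s0 s01) ltr01.
  pose M := `|d 1%N s0| + 1; have M0 : 0 < M by rewrite ltr_wpDl.
  exists (Num.min r (eta / M)); first by rewrite lt_min r0 divr_gt0.
  move=> s s01'; rewrite lt_min => /andP[sr seta].
  have : `|h0 s| <= M * `|s - s0|.
    have := H s; rewrite /= in_itv/= => /(_ s01' sr).
    rewrite !d0h// hs0 -/(h0 s) mul1r => le.
    rewrite -[h0 s](subrK (d 1%N s0 * (s - s0))) (le_trans (ler_normD _ _))//.
    by rewrite normrM /M mulrDl mul1r addrC lerD.
  move=> /le_trans; apply; rewrite mulrC -ler_pdivlMr//; exact: ltW.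
have z01 : 0 <= (0 : R) <= 1 by rewrite lexx ler01.
have o01 : 0 <= (1 : R) <= 1 by rewrite lexx ler01.
have [r0 r00 H0] := nearpt 0 z01 erefl.
have [r1 r10 H1] := nearpt 1 o01 h1.
(* The zones of width 2 dl at both ends, where the cutoff is not 1, then lie within the radii on
   which |h0| <= eta. *)
pose dl := Num.min r0 r1 / 4.
have dl0 : 0 < dl by rewrite divr_gt0// lt_min r00.
have dlr0 : 4 * dl <= r0 by rewrite /dl mulrC divfK// ge_min lexx.
have dlr1 : 4 * dl <= r1 by rewrite /dl mulrC divfK// ge_min lexx orbT.
pose w s := cell_cutoff dl s * e 0%N s.
have sw : smooth w.
  move=> n; apply: (diffn_vanish_mul _ _ dl0 (vanish_cell_cutoff dl0) _ de).
  exact: smooth_cell_cutoff.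
have vw : vanish dl w by move=> s hs; rewrite /w vanish_cell_cutoff// mul0r.
have h0f x : e 0%N (fract x) = h0 x.
  have /andP[f0 f1] := fract_itv x.
  by rewrite /e d0h ?f0 ?(ltW f1)// periodic1_fract.
exists (w \o @fract R); split.
- exact: smooth_fract dl0 vw sw.
- by move=> x; rewrite /= fractD1.
- move=> x /=; rewrite /w h0f normrM -[leRHS]mul1r.
  have /andP[c0 c1] := cell_cutoff_itv dl (fract x).
  by rewrite ler_pM// ger0_norm.
- move=> x /=; rewrite /w h0f -{2}[h0 x]mul1r -mulrBl normrM.
  have /andP[f0 f1] := fract_itv x.
  have /andP[c0 c1] := cell_cutoff_itv dl (fract x).
  have [mid|nmid] := boolP (2 * dl <= fract x <= 1 - 2 * dl).
    by rewrite cell_cutoff1// subrr normr0 mul0r ltW.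
  have : `|h0 (fract x)| <= eta.
    move: nmid; rewrite negb_and -!ltNge => /orP[lx|lx].
      by apply: H0; [lra|rewrite subr0 ger0_norm//; lra].
    by apply: H1; [lra|rewrite distrC ger0_norm; lra].
  have -> : h0 (fract x) = h0 x by rewrite /h0 periodic1_fract.
  move=> le; rewrite -[leRHS]mul1r ler_pM//.
  by rewrite distrC ger0_norm; lra.
Qed.

(** Continuity across the integers is inherited from the uniform approximation by smooth periodic
    functions. *)
Lemma cell_continuous : continuous h.
Proof.
suff ch0 : continuous h0.
  move=> x; rewrite (_ : h = fun x => h0 x + h 0).
    by apply: cvgD; [exact: ch0|exact: cvg_cst].
  by apply/funext => y; rewrite /h0 subrK.
move=> x; apply/cvgrPdist_le => e e0.
have e30 : 0 < e / 3 by rewrite divr_gt0.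
have [w [sw _ _ we]] := cell_approx e30.
have /cvgrPdist_le/(_ _ e30) := smooth_continuous sw (x := x).
apply: filterS => y wy.
have -> : h0 x - h0 y = - (w x - h0 x) + (w x - w y) + (w y - h0 y) by ring.
rewrite (le_trans (ler_normD _ _))// (le_trans (lerD (ler_normD _ _) (lexx
  _)))//.
rewrite normrN; have := we x; have := we y; lra.
Qed.

(** The smooth estimate holds for every approximant w with a bound independent of eta; as |w| <= 2c,
    the constant 2c there becomes 4c here. Letting eta tend to 0 transfers it to h. *)
Lemma kernel_cell_le (n : nat) (K g : R -> R) (V : R) :
  mu.-integrable setT (EFin \o K) -> \int[mu]_t K t = 1 ->
  (forall u : R, ~~ (- (1 / 2) <= u <= 1 / 2) -> K u = 0) ->
  weak_deriv n K g ->
  (forall phi : R -> R, (forall x, derivable phi x 1) ->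
     continuous (derive1 phi) -> compactly_supported phi ->
     (forall x, `|phi x| <= 1) -> \int[mu]_x (g x * derive1 phi x) <= V) ->
  forall a b : R, 0 < c -> 0 < b ->
  `|\int[mu]_u (K u * h (a + b * u)) - mean h| <= 4 * c * V / b ^+ n.+1.
Proof.
move=> iK K1 K0 wK bvg a b c0 b0.
have iJ (f : R -> R) (C : R) : continuous f -> (forall x, `|f x| <= C) ->
    mu.-integrable setT (EFin \o (fun u => K u * f (a + b * u))).
  move=> cf fc; apply: (@integrable_bounded_mul _ _ _ _ C) => //.
  by apply: continuous_measurable_fun; exact: continuous_affine.
have ch := cell_continuous.
have ch0 : continuous h0.
  by move=> x; apply: cvgB; [exact: ch|exact: cvg_cst].
pose J (f : R -> R) := \int[mu]_u (K u * f (a + b * u)) - mean f.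
(* Since K has mass 1, subtracting the constant h 0 changes both terms equally. *)
have -> : \int[mu]_u (K u * h (a + b * u)) - mean h = J h0.
  rewrite /J /h0 meanB// opprB addrA; congr (_ - _).
  apply/eqP; rewrite -subr_eq; apply/eqP.
  rewrite -[X in _ - X = _]mulr1 -[X in _ - _ * X = _]K1 -RintegralZl//
    -RintegralB//;
    last 2 first.
  - exact: (iJ _ c).
  - exact: (integrableZl _ (h 0) iK).
  by apply: eq_Rintegral => x _; ring.
pose k1 := \int[mu]_u `|K u|.
have k10 : 0 <= k1 by exact: Rintegral_ge0.
apply/ler_addgt0Pr => eps eps0.
(* Replacing w by [h0] costs eta k1 in the integral and eta in the mean, that is eps in total. *)
pose eta := eps / (k1 + 1).
have eta0 : 0 < eta by rewrite divr_gt0// ltr_wpDl.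
have [w [sw pw wc we]] := cell_approx eta0.
have cw := smooth_continuous sw.
have c20 : 0 < 2 * c by rewrite mulr_gt0.
have := kernel_smooth_le iK K1 K0 wK bvg a sw pw c20 wc b0;
  rewrite -/(J w) => Jw.
have -> : J h0 = J w - (J w - J h0) by ring.
rewrite (le_trans (ler_normB _ _))// lerD//;
  first by rewrite (le_trans Jw)// mulrA -natrM.
have cwh : continuous (fun x => w x - h0 x).
  by move=> x; apply: cvgB; [exact: cw|exact: ch0].
have -> : J w - J h0 = J (fun x => w x - h0 x).
  have -> : J (fun x => w x - h0 x) =
      \int[mu]_u (K u * (w (a + b * u) - h0 (a + b * u))) - (mean w - mean h0).
    congr (_ - _); apply: RintegralB => //; exact: continuous_itv_integrable.
  rewrite /J.
  rewrite (_ : (\int[mu]_u (K u * (w (a + b * u) - h0 (a + b * u)))) =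
    \int[mu]_u (K u * w (a + b * u)) - \int[mu]_u (K u * h0 (a + b * u)));
      first by ring.
  rewrite -RintegralB//; [|exact: iJ wc|exact: iJ h0c].
  by apply: eq_Rintegral => x _; ring.
have -> : eps = eta * k1 + eta by rewrite /eta; field;
  rewrite gt_eqF// ltr_wpDl.
rewrite (le_trans (ler_normB _ _))// lerD//; last exact: mean_le.
have iwh := iJ _ _ cwh we.
rewrite (le_trans (le_normr_Rintegral _ iwh))// /k1 -RintegralZl//; last first.
  exact: (integrable_abse iK).
apply: le_Rintegral => //.
- exact: (integrable_abse iwh).
- exact: (integrableZl _ eta (integrable_abse iK)).
by move=> x _; rewrite normrM mulrC ler_wpM2r.
Qed.

End Cell.
End CellKernel.

(** * Affine substitution *)

Section AffineSubstitution.
Context {R : realType}.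
Local Notation mu := (@lebesgue_measure R).

Variables (a b : R).
Hypothesis b0 : 0 < b.

Let phi (u : measurableTypeR R) : measurableTypeR R := a + b * u.

Let cphi : continuous (phi : R -> R).
Proof. by apply: (@continuous_affine _ id) => x; exact: cvg_id. Qed.

Let mphi : measurable_fun setT phi.
Proof. by apply: continuous_measurable_fun; exact: cphi. Qed.

Let k : {nonneg R} := NngNum (ltW b0).

(** Lebesgue measure is determined by its values on half-open intervals; the factor b undoes the
    contraction of lengths in the preimage. *)
Lemma pushforward_affine (A : set R) : measurable A ->
  pushforward (mscale k mu) phi A = mu A.
Proof.
move=> mA; apply/esym/lebesgue_measure_unique => //= _ [[x y]] _ <-.
rewrite /pushforward /mscale /=.
have -> : phi @^-1` `]x, y]%classic = `](x - a) / b, (y - a) / b]%classic.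
  apply/seteqP; split => u /=;
    rewrite /phi !in_itv/= ltr_pdivrMr// ler_pdivlMr//.
    by move=> /andP[? ?]; apply/andP; split; lra.
  by move=> /andP[? ?]; apply/andP; split; lra.
rewrite !lebesgue_measure_itv/= !lte_fin ltr_pM2r ?invr_gt0// ltrD2r.
case: ifP => _; last by rewrite mule0.
by rewrite !EFinN -!EFinD -EFinM; congr EFin; field; rewrite gt_eqF.
Qed.

Lemma ge0_integral_affine (f : R -> \bar R) :
  measurable_fun setT f -> (forall x, 0 <= f x)%E ->
  (\int[mu]_x f x = b%:E * \int[mu]_u f (a + b * u)%R)%E.
Proof.
move=> mf f0; transitivity (\int[pushforward (mscale k mu) phi]_x f x)%E.
  by apply: eq_measure_integral => A mA _; apply/esym/pushforward_affine.
rewrite ge0_integral_pushforward// preimage_setT ge0_integral_mscale//.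
  exact: (measurableT_comp mf mphi).
by move=> x _; exact: f0.
Qed.

Lemma affine_integrable (f : R -> R) : mu.-integrable setT (EFin \o f) ->
  mu.-integrable setT (EFin \o (fun u => f (a + b * u))).
Proof.
move=> /integrableP[mf foo]; apply/integrableP; split.
  exact: (measurableT_comp mf mphi).
move: foo; rewrite (@ge0_integral_affine (fun x => `|(f x)%:E|)%E)//;
  last first.
  exact: measurableT_comp.
rewrite muleC; apply: contraTT; rewrite -!leNgt !leye_eq => /eqP ->.
by rewrite mulyr gtr0_sg// mul1e.
Qed.

Lemma Rintegral_affine (f : R -> R) : mu.-integrable setT (EFin \o f) ->
  \int[mu]_x f x = b * \int[mu]_u f (a + b * u).
Proof.
move=> fi; have fai := affine_integrable fi.
have mf := measurable_int _ fi.
suff E : (\int[mu]_x (f x)%:E = b%:E * \int[mu]_u (f (a + b * u)%R)%:E)%E.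
  rewrite /Rintegral E fineM//.
  by apply: integrable_fin_num; [|exact: fai].
rewrite [in LHS]integralE [X in (_ * X)%E]integralE.
rewrite muleBr//; last first.
  rewrite fin_num_adde_defl// fin_numN; apply: integrable_fin_num => //.
  by apply: integrable_funeneg => //; exact: fai.
congr (_ - _)%E.
- rewrite ge0_integral_affine//; last exact: (measurable_funepos mf).
  by congr (_ * _)%E; apply: eq_integral => u _; rewrite !funeposE.
- rewrite ge0_integral_affine//; last exact: (measurable_funeneg mf).
  by congr (_ * _)%E; apply: eq_integral => u _; rewrite !funenegE.
Qed.

End AffineSubstitution.

(** * Skew fields and the micro solution *)

Section Euclidean.
Context {R : realType}.
Implicit Types (u v : 'cV[R]_3).

Lemma sum_ord3 (F : 'I_3 -> R) : \sum_(i < 3) F i = F 0 + (F 1 + F 2).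
Proof.
by rewrite !big_ord_recl big_ord0 addr0; do ?congr (_ + _); congr F;
  exact: val_inj.
Qed.

Definition dotv u v : R := \sum_(i < 3) u i 0 * v i 0.

Lemma dotvC u v : dotv u v = dotv v u.
Proof. by apply: eq_bigr => i _; rewrite mulrC. Qed.

Lemma dotvDl u v w : dotv (u + v) w = dotv u w + dotv v w.
Proof. by rewrite /dotv -big_split; apply: eq_bigr => i _;
  rewrite mxE mulrDl. Qed.

Lemma dotvZl a u v : dotv (a *: u) v = a * dotv u v.
Proof. by rewrite /dotv mulr_sumr; apply: eq_bigr => i _;
  rewrite mxE mulrA. Qed.

Lemma dotvv_ge0 u : 0 <= dotv u u.
Proof. by apply: sumr_ge0 => i _; rewrite -expr2 sqr_ge0. Qed.

Lemma enormE u : enorm u = Num.sqrt (dotv u u).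
Proof. by rewrite /enorm; congr Num.sqrt; apply: eq_bigr => i _;
  rewrite expr2. Qed.

Lemma sqr_enorm u : enorm u ^+ 2 = dotv u u.
Proof. by rewrite enormE sqr_sqrtr// dotvv_ge0. Qed.

Lemma enorm_ge0 u : 0 <= enorm u.
Proof. by rewrite enormE sqrtr_ge0. Qed.

(** Lagrange's identity: the gap in the squared Cauchy-Schwarz inequality is the sum of the three
    squares handed to [nra]. *)
Lemma dotv_le u v : dotv u v <= enorm u * enorm v.
Proof.
rewrite !enormE -sqrtrM ?dotvv_ge0// (le_trans (ler_norm _))//.
rewrite -sqrtr_sqr ler_wsqrtr// /dotv !big_ord_recl !big_ord0 /=.
move: (u _ _) (u _ _) (u _ _) (v _ _) (v _ _) (v _ _) => a b c x y z.
have := sqr_ge0 (a * y - b * x); have := sqr_ge0 (a * z - c * x).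
have := sqr_ge0 (b * z - c * y); nra.
Qed.

Lemma enormD u v : enorm (u + v) <= enorm u + enorm v.
Proof.
rewrite -(@ler_pXn2r _ 2) ?nnegrE ?addr_ge0 ?enorm_ge0//.
rewrite sqrrD !sqr_enorm dotvDl 2!(dotvC _ (u + v)) !dotvDl (dotvC v u).
by have := dotv_le u v; lra.
Qed.

Lemma coord_le_enorm u i : `|u i 0| <= enorm u.
Proof.
rewrite -(@ler_pXn2r _ 2) ?nnegrE ?enorm_ge0// sqr_enorm real_normK ?num_real//.
by rewrite /dotv (bigD1 i)//= -expr2 lerDl sumr_ge0// => j _;
  rewrite -expr2 sqr_ge0.
Qed.

Lemma enorm_le u (c : R) : (forall i, `|u i 0| <= c) -> enorm u <= 3 * c.
Proof.
move=> uc; have c0 : 0 <= c := le_trans (normr_ge0 _) (uc 0).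
rewrite -(@ler_pXn2r _ 2) ?nnegrE ?mulr_ge0 ?enorm_ge0// sqr_enorm.
apply: (@le_trans _ _ (\sum_(i < 3) c ^+ 2)).
  apply: ler_sum => i _; rewrite -expr2 -real_normK ?num_real//.
  by rewrite ler_pXn2r ?nnegrE.
by rewrite sumr_const card_ord -mulr_natl; have := sqr_ge0 c; rewrite exprMn;
  lra.
Qed.

(** Exchanging the two indices turns the quadratic form into its opposite. Norm conservation and
    stability of the scheme both rest on this. *)
Lemma dotv_skew (A : 'M[R]_3) v : (forall i j, A i j = - A j i) ->
  dotv (A *m v) v = 0.
Proof.
move=> skA; suff E : dotv (A *m v) v = - dotv (A *m v) v by lra.
rewrite /dotv; under eq_bigr => i _ do rewrite mxE mulr_suml.
rewrite [LHS]exchange_big /= -sumrN; apply: eq_bigr => i _.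
rewrite -sumrN; apply: eq_bigr => j _; rewrite (skA j i); ring.
Qed.

Lemma skew_mx_anti (h1 h2 h3 : R) i j :
  skew_mx h1 h2 h3 i j = - skew_mx h1 h2 h3 j i.
Proof.
rewrite !mxE; case: i => [[|[|[|//]]] ?]; case: j => [[|[|[|//]]] ?] /=;
  by rewrite ?oppr0 ?opprK.
Qed.

End Euclidean.

(** * Matrix-valued relative derivatives and the mean value inequality *)

Section MatrixLimits.
Context {R : realType}.

Lemma is_deriv_in_coord m n (A : set R) (f : R -> 'M[R]_(m.+1, n.+1)) (x : R)
    (l : 'M[R]_(m.+1, n.+1)) i j :
  is_deriv_in A f x l -> is_deriv_in A (fun y => f y i j) x (l i j).
Proof.
move=> df; rewrite /is_deriv_in.
rewrite (_ : diff_quotient _ x = (fun M :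
  'M[R]_(m.+1, n.+1) => M i j) \o diff_quotient f x).
  exact: (cvg_comp _ _ df (@coord_continuous _ _ _ i j l)).
by apply/funext => y; rewrite /diff_quotient /= !mxE.
Qed.

Lemma is_deriv_in_mx m n (A : set R) (f : R -> 'M[R]_(m.+1, n.+1)) (x : R)
    (l : 'M[R]_(m.+1, n.+1)) :
  (forall i j, is_deriv_in A (fun y => f y i j) x (l i j)) ->
  is_deriv_in A f x l.
Proof.
move=> df; apply/cvgrPdist_le => /= e e0.
near=> y.
rewrite /Num.Def.normr/= mx_normrE (bigmax_le _ (ltW e0))//= => i _.
rewrite !mxE/=; move: i; near: y; apply: filter_forall => /= i.
exact: ((cvgrPdist_le _ _).1 (df i.1 i.2)).
Unshelve. all: by end_near. Qed.

(** Properness of the filter gives uniqueness of limits, so that [deriv_in] is the derivative even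
    at the endpoints. *)
Lemma itv_dnbhs_proper (a b x : R) : a < b -> a <= x <= b ->
  ProperFilter (within `[a, b] x^').
Proof.
move=> ab /andP[ax xb]; apply: Build_ProperFilter_ex => P wP.
have : \forall y \near within `[a, b] x^', P y by exact: wP.
rewrite near_withinE near_withinE => /nbhs_ballP[d /= d0 H].
have [xb'|bx] := ltP x b.
  exists (Num.min b (x + d / 2)); have [h|h] := leP b (x + d / 2).
  - by apply: H; rewrite /ball/= ?in_itv/= ?gt_eqF ?ltr0_norm; lra.
  - by apply: H; rewrite /ball/= ?in_itv/= ?gt_eqF ?ltr0_norm; lra.
exists (Num.max a (x - d / 2)); have [h|h] := leP a (x - d / 2).
- by apply: H; rewrite /ball/= ?in_itv/= ?lt_eqF ?gtr0_norm; lra.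
- by apply: H; rewrite /ball/= ?in_itv/= ?lt_eqF ?gtr0_norm; lra.
Qed.

Lemma deriv_inE (V : normedModType R) (a b : R) (f : R -> V) x l :
  a < b -> a <= x <= b -> is_deriv_in `[a, b] f x l -> deriv_in `[a, b] f x = l.
Proof.
move=> ab xab df; have PF := itv_dnbhs_proper ab xab.
by apply: cvg_lim => //; exact: norm_hausdorff.
Qed.

(** The mean value theorem: relative derivatives are ordinary ones in the interior and give
    continuity up to the endpoints. *)
Lemma is_deriv_in_lipschitz (a b : R) (f f' : R -> R) (L : R) :
  (forall x, a <= x <= b -> is_deriv_in `[a, b] f x (f' x)) ->
  (forall x, a <= x <= b -> `|f' x| <= L) ->
  forall x y, a <= x <= b -> a <= y <= b -> `|f x - f y| <= L * `|x - y|.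
Proof.
move=> df f'L.
suff main x y : a <= x <= b -> a <= y <= b -> x < y ->
  `|f x - f y| <= L * `|x - y|.
  move=> x y xab yab; have [xy|yx|->] := ltgtP x y; first exact: main.
  - by rewrite distrC (distrC x); exact: main.
  - by rewrite !subrr normr0 mulr0.
move=> xab yab xy.
have dfz z : z \in `]x, y[ -> is_derive z 1 f (f' z).
  move=> /[dup] zxy; rewrite in_itv/= => /andP[xz zy].
  apply: (@is_deriv_in_is_derive _ `[a, b]); last by apply: df; lra.
  by move/near_in_itvoo: zxy; apply: filterS => w; rewrite /= !in_itv/=; lra.
have cf : {within `[x, y], continuous f}.
  apply: (@continuous_subspaceW _ _ _ `[a, b]).
    by move=> w; rewrite /= !in_itv/=; lra.
  by apply: (@is_deriv_in_continuous _ _ _ f') => w; rewrite /= in_itv/=;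
    exact: df.
have [z] := MVT xy dfz cf; rewrite in_itv/= => /andP[xz zy].
rewrite distrC [X in _ <= _ * X]distrC => ->; rewrite normrM ler_wpM2r//.
by apply: f'L; lra.
Qed.

End MatrixLimits.

(** * Regularity and skewness of the field and of its average *)

Section Field.
Context {R : realType}.
Local Notation mu := (@lebesgue_measure R).

Lemma mx_entry_le (A : 'M[R]_3) (c : R) :
  (forall v, enorm (A *m v) <= c * enorm v) -> forall i j, `|A i j| <= c.
Proof.
move=> Ac i j; have := Ac (delta_mx j 0).
have -> : enorm (delta_mx j 0 : 'cV[R]_3) = 1.
  rewrite enormE /dotv (bigD1 j)//= big1 ?mxE ?eqxx ?mulr1 ?addr0 ?sqrtr1// =>
    k kj.
  by rewrite mxE (negbTE kj) mul0r.
rewrite mulr1 -colE; apply: le_trans.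
by have := coord_le_enorm (col j A) i; rewrite mxE.
Qed.

Variables (T c1 : R) (H : R -> R -> 'M[R]_3).
Hypotheses (T0 : 0 < T) (hH : is_field T c1 H).

Lemma field_entry_le t s i j : 0 <= t <= T -> `|H t s i j| <= c1.
Proof.
by move=> tT; apply: mx_entry_le => v; apply: (field_bound hH); rewrite in_itv.
Qed.

Lemma field_const_ge0 : 0 <= c1.
Proof.
by apply: le_trans (normr_ge0 _) (@field_entry_le 0 0 0 0 _); rewrite lexx ltW.
Qed.

Lemma field_anti t s i j : 0 <= t <= T -> H t s i j = - H t s j i.
Proof.
move=> tT; have [|h1 [h2 [h3 ->]]] := @field_skew _ _ _ _ hH t s.
  by rewrite in_itv.
exact: skew_mx_anti.
Qed.

Lemma field_periodic1 t i j : 0 <= t <= T -> periodic1 (fun s => H t s i j).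
Proof. by move=> tT s; rewrite (field_periodic hH)// in_itv. Qed.

Lemma field_cell t i j : 0 <= t <= T -> exists d : nat -> R -> R,
  (forall s, 0 <= s <= 1 -> d 0%N s = H t s i j) /\
  (forall l s, 0 <= s <= 1 -> is_deriv_in `[0, 1] (d l) s (d l.+1 s)).
Proof.
move=> tT; have [D [D0 _ _ Ds]] := field_smooth hH i j.
exists (fun l => D 0%N l t); split.
  by move=> s s1; apply: D0; rewrite /= in_itv.
by move=> l s s1; apply: Ds; rewrite /= in_itv.
Qed.

Lemma field_continuous t i j : 0 <= t <= T -> continuous (fun s => H t s i j).
Proof.
move=> tT; have [d [d0 dS]] := field_cell i j tT.
apply: (@cell_continuous _ _ d c1) => //; first exact: field_periodic1.
by move=> s; exact: field_entry_le.
Qed.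

(** Smoothness gives derivatives entry by entry, while the bound concerns [deriv_in] of the matrix;
    the entries are assembled into a matrix and identified with it. *)
Lemma field_dt s : 0 <= s <= 1 -> exists D : R -> 'M[R]_3,
  (forall t i j, 0 <= t <= T ->
     is_deriv_in `[0, T] (fun t => H t s i j) t (D t i j)) /\
  (forall t i j, 0 <= t <= T -> `|D t i j| <= c1).
Proof.
move=> s1; have /choice[D DP] : forall ij : 'I_3 * 'I_3, exists D : R -> R,
    forall t, 0 <= t <= T -> is_deriv_in `[0, T] (fun t => H t s ij.1 ij.2) t
      (D t).
  move=> [i j]; have [D [D0 _ Dt _]] := field_smooth hH i j.
  exists (fun t => D 1%N 0%N t s) => t tT /=.
  apply: (@is_deriv_in_eq _ _ (fun t => D 0%N 0%N t s));
    first by rewrite /= in_itv.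
    by move=> y yT; apply: D0; rewrite /= in_itv.
  by apply: Dt; rewrite /= in_itv.
pose D' t : 'M[R]_3 := \matrix_(i, j) D (i, j) t.
have dD' t i j : 0 <= t <= T ->
    is_deriv_in `[0, T] (fun t => H t s i j) t (D' t i j).
  by move=> tT; rewrite mxE; exact: (DP (i, j)).
exists D'; split=> // t i j tT; apply: mx_entry_le => v.
have <- : deriv_in `[0, T] (H ^~ s) t = D' t.
  by apply: deriv_inE => //; apply: is_deriv_in_mx => k l; exact: dD'.
by apply: (field_bound_dt hH); rewrite in_itv.
Qed.

(** Periodicity moves s into the cell [0, 1], where the t-derivative exists and is bounded by c1. *)
Lemma field_lipschitz t t' s i j : 0 <= t <= T -> 0 <= t' <= T ->
  `|H t s i j - H t' s i j| <= c1 * `|t - t'|.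
Proof.
move=> tT tT'.
rewrite -(periodic1_fract s (field_periodic1 i j tT)).
rewrite -(periodic1_fract s (field_periodic1 i j tT')).
have /andP[f0 f1] := fract_itv s.
have s1 : 0 <= fract s <= 1 by rewrite f0 ltW.
have [D [dD Dc]] := field_dt s1.
apply: (@is_deriv_in_lipschitz _ 0 T (fun t => H t (fract s) i j) (fun t => D t
  i j)) => //.
- by move=> x xT; exact: dD.
- by move=> x xT; exact: Dc.
Qed.

(** The path s / eps leaves the cell on which joint continuity is assumed. Continuity in the fast
    variable is combined with the Lipschitz bound in t, uniform in s. *)
Lemma field_diagonal_continuous (eps : R) i j :
  {within `[0, T], continuous (fun s => H s (s / eps) i j)}.
Proof.
apply/subspace_continuousP => s; rewrite /= in_itv/= => sT.
apply/cvgrPdist_le => e e0; rewrite near_withinE.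
have e20 : 0 < e / 2 by rewrite divr_gt0.
have cH := @field_continuous s i j sT (s / eps).
have cs : (fun y => y / eps) y @[y --> s] --> s / eps.
  by apply: cvgM; [exact: cvg_id|exact: cvg_cst].
have /cvgrPdist_le/(_ _ e20) Hs := cvg_comp _ _ cs cH.
have c0 : 0 < c1 + 1 by rewrite ltr_wpDl// field_const_ge0.
have ys : \forall y \near s, `|s - y| < e / 2 / (c1 + 1).
  by apply/nbhs_ballP; exists (e / 2 / (c1 + 1)); rewrite //= divr_gt0.
near=> y => /=; rewrite in_itv/= => yT.
have h1 : `|H s (s / eps) i j - H s (y / eps) i j| <= e / 2 by near: y.
have h2 : `|H s (y / eps) i j - H y (y / eps) i j| <= e / 2.
  rewrite (le_trans (field_lipschitz _ _ _ sT yT))//.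
  have /ltW : `|s - y| < e / 2 / (c1 + 1) by near: y.
  rewrite ler_pdivlMr// mulrC; apply: le_trans.
  by rewrite ler_wpM2r// lerDl.
suff : `|H s (s / eps) i j - H y (y / eps) i j| <= e by [].
by rewrite -[H s (s / eps) i j](subrK (H s (y / eps) i j)) -addrA
  (le_trans (ler_normD _ _))//; lra.
Unshelve. all: by end_near. Qed.

Lemma avg_field_mean t i j : avg_field H t i j = mean (fun s => H t s i j).
Proof. by rewrite mxE. Qed.

Lemma avg_field_anti t i j : 0 <= t <= T ->
  avg_field H t i j = - avg_field H t j i.
Proof.
move=> tT; rewrite !avg_field_mean /mean -mulN1r -RintegralZl//.
  by apply: eq_Rintegral => s _; rewrite mulN1r (field_anti s i j tT).
by apply: continuous_itv_integrable; exact: field_continuous.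
Qed.

(** * A priori estimates for the micro solution *)

Section Micro.
Variables (eps tau ta : R) (M : 'cV[R]_3) (m : R -> 'cV[R]_3).
Hypotheses (tau0 : 0 < tau) (ta0 : 0 <= ta - tau / 2) (taT : ta + tau / 2 <= T).
Hypothesis hm : micro_solution H eps tau ta M m.

Let I : set R := `[ta - tau / 2, ta + tau / 2].
Let g s : 'cV[R]_3 := - (H s (s / eps) *m m s).

Let inT (s : R) : ta - tau / 2 <= s <= ta + tau / 2 -> 0 <= s <= T.
Proof. by have := ta0; have := taT; move=> ? ? /andP[? ?]; lra. Qed.

Let dm (s : R) i : ta - tau / 2 <= s <= ta + tau / 2 ->
  is_deriv_in I (fun s => m s i 0) s (g s i 0).
Proof.
move=> sI; apply: (@is_deriv_in_coord _ 2 0); apply: hm.2.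
by rewrite /= in_itv.
Qed.

Let taI : ta - tau / 2 <= ta <= ta + tau / 2.
Proof. by have := tau0; lra. Qed.

(** The squared norm has derivative 2 g . m = 0 by skewness, so it is Lipschitz with constant 0. *)
Lemma micro_norm (s : R) : ta - tau / 2 <= s <= ta + tau / 2 ->
  enorm (m s) = enorm M.
Proof.
move=> sI; rewrite !enormE; congr Num.sqrt; rewrite -(hm.1).
pose N s := m s 0 0 * m s 0 0 + (m s 1 0 * m s 1 0 + m s 2 0 * m s 2 0).
have dotN x : dotv (m x) (m x) = N x.
  by rewrite /dotv sum_ord3.
have dN (x : R) : ta - tau / 2 <= x <= ta + tau / 2 -> is_deriv_in I N x 0.
  move=> xI; have := is_deriv_inD (is_deriv_inM (@dm x 0 xI) (@dm x 0 xI))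
    (is_deriv_inD (is_deriv_inM (@dm x 1 xI) (@dm x 1 xI))
                  (is_deriv_inM (@dm x 2 xI) (@dm x 2 xI))).
  congr (is_deriv_in _ _ _ _).
  have : dotv (g x) (m x) = 0.
    rewrite /g -scaleN1r dotvZl dotv_skew ?mulr0// => i j.
    exact: field_anti (inT xI).
  by rewrite /dotv sum_ord3; lra.
apply/eqP; rewrite !dotN -subr_eq0 -normr_le0.
rewrite (le_trans (is_deriv_in_lipschitz (L := 0) dN _ sI taI)) ?mul0r//.
by move=> x _; rewrite normr0.
Qed.

Lemma micro_deriv_le (s : R) i : ta - tau / 2 <= s <= ta + tau / 2 ->
  `|g s i 0| <= c1 * enorm M.
Proof.
move=> sI; rewrite /g mxE normrN (le_trans (coord_le_enorm _ _))//.
rewrite -(micro_norm sI); apply: (field_bound hH); rewrite in_itv/=; exact: inT.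
Qed.

Lemma micro_close (s : R) i : ta - tau / 2 <= s <= ta + tau / 2 ->
  `|m s i 0 - M i 0| <= c1 * enorm M * tau.
Proof.
move=> sI; have := is_deriv_in_lipschitz (fun x => @dm x i)
  (fun x => @micro_deriv_le x i) sI taI.
rewrite (hm.1) => /le_trans; apply.
rewrite ler_wpM2l//; last by rewrite ler_norml; have := tau0; lra.
by rewrite mulr_ge0 ?field_const_ge0 ?enorm_ge0.
Qed.

(** Freezing the slow time at ta costs c1 tau |M| per entry, and freezing the state at M costs c1^2
    tau |M|; summing over j gives the factor 3. *)
Lemma micro_deriv_close (s : R) i : ta - tau / 2 <= s <= ta + tau / 2 ->
  `|g s i 0 + \sum_j H ta (s / eps) i j * M j 0| <=
  3 * (c1 + c1 ^+ 2) * enorm M * tau.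
Proof.
move=> sI; rewrite /g !mxE addrC -sumrB.
rewrite (le_trans (ler_norm_sum _ _ _))//.
apply: (@le_trans _ _ (\sum_(j < 3) (c1 + c1 ^+ 2) * enorm M * tau));
  last first.
  by rewrite sum_ord3; lra.
have c10 := field_const_ge0; have M0 := enorm_ge0 M.
apply: ler_sum => j _.
have -> : H ta (s / eps) i j * M j 0 - H s (s / eps) i j * m s j 0 =
    (H ta (s / eps) i j - H s (s / eps) i j) * m s j 0 -
    H ta (s / eps) i j * (m s j 0 - M j 0) by ring.
rewrite (le_trans (ler_normB _ _))// !normrM !mulrDl lerD//.
  rewrite mulrAC ler_pM//.
    rewrite (le_trans (field_lipschitz _ _ _ (inT taI) (inT sI)))//.
    by rewrite ler_wpM2l// ler_norml; lra.
  by rewrite -(micro_norm sI) coord_le_enorm.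
by rewrite expr2 -2!mulrA ler_pM// ?mulrA ?micro_close// field_entry_le// inT.
Qed.

Lemma micro_deriv_continuous i : {within I, continuous (fun s => g s i 0)}.
Proof.
have cm j : {within I, continuous (fun s => m s j 0)}.
  apply: (@is_deriv_in_continuous _ _ _ (fun s => g s j 0)) => s.
  by rewrite /I/= in_itv/=; exact: dm.
have cH j : {within I, continuous (fun s => H s (s / eps) i j)}.
  apply: continuous_subspaceW (@field_diagonal_continuous eps i j).
  by move=> s; rewrite /I/= !in_itv/=; exact: inT.
rewrite (_ : (fun s => g s i 0) = fun s => - (H s (s / eps) i 0 * m s 0 0 +
    (H s (s / eps) i 1 * m s 1 0 + H s (s / eps) i 2 * m s 2 0))).
  apply/subspace_continuousP => s Is.
  have cH' j := (subspace_continuousP _ _).1 (cH j) s Is.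
  have cm' j := (subspace_continuousP _ _).1 (cm j) s Is.
  by apply: cvgN; repeat apply: cvgD; apply: cvgM; by [exact: cH'|exact: cm'].
by apply/funext => s; rewrite /g mxE mxE sum_ord3.
Qed.

Lemma micro_deriv_inE (s : R) i : ta - tau / 2 <= s <= ta + tau / 2 ->
  deriv_in I m s i 0 = g s i 0.
Proof.
move=> sI; congr (fun_of_matrix _ i 0); apply: deriv_inE => //.
  by have := tau0; lra.
by apply: hm.2; rewrite /= in_itv.
Qed.

End Micro.
End Field.

(** * Consistency of the upscaled flux *)

Section ScaledKernel.
Context {R : realType}.
Local Notation mu := (@lebesgue_measure R).
Variables (K : R -> R) (tau ta : R).
Hypotheses (tau0 : 0 < tau) (iK : mu.-integrable setT (EFin \o K)).
Hypothesis K0 : forall u : R, ~~ (- (1 / 2) <= u <= 1 / 2) -> K u = 0.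

Let w (s : R) := scaled_kernel K tau (s - ta).

Let wE s : w s = tau^-1 * K (- (ta / tau) + tau^-1 * s).
Proof. by rewrite /w /scaled_kernel; congr (_ * K _); ring. Qed.

Lemma scaled_kernel_integrable : mu.-integrable setT (EFin \o w).
Proof.
have := affine_integrable (- (ta / tau)) (_ : 0 < tau^-1) iK.
rewrite invr_gt0 => /(_ tau0) /(integrableZl measurableT tau^-1).
by apply: eq_integrable => // s _; rewrite /= wE EFinM.
Qed.

(** Substitution s = ta + tau u. The window is the image of [-1/2, 1/2], outside which K vanishes,
    so the integral extends to the whole line. *)
Lemma Rintegral_scaled_kernel (f : R -> R) :
  mu.-integrable setT (EFin \o (fun u => K u * f (ta + tau * u))) ->
  \int[mu]_(s in `[ta - tau / 2, ta + tau / 2]) (w s * f s) =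
  \int[mu]_u (K u * f (ta + tau * u)).
Proof.
move=> iKf; have tauV0 : 0 < tau^-1 by rewrite invr_gt0.
have tau_neq0 : tau != 0 by rewrite gt_eqF.
have iaff := affine_integrable (- (ta / tau)) tauV0 iKf.
rewrite (Rintegral_affine (- (ta / tau)) tauV0 iKf) -RintegralZl//.
rewrite Rintegral_mkcond; apply: eq_Rintegral => s _.
have -> : ta + tau * (- (ta / tau) + tau^-1 * s) = s by field.
rewrite mulrA -wE patchE; case: ifPn => //.
rewrite notin_setE /= in_itv/= => /negP hs;
  rewrite -/(w s) wE K0 ?mulr0 ?mul0r//.
apply: contraNN hs => /andP[h1 h2].
have -> : s = ta + tau * (- (ta / tau) + tau^-1 * s) by field.
by have := tau0; nra.
Qed.

End ScaledKernel.

Lemma Rintegral_norm_scaled_kernel (R : realType) (K : R -> R) (tau ta : R) :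
  0 < tau -> (@lebesgue_measure R).-integrable setT (EFin \o K) ->
  (forall u : R, ~~ (- (1 / 2) <= u <= 1 / 2) -> K u = 0) ->
  \int[@lebesgue_measure R]_(s in `[ta - tau / 2, ta + tau / 2])
    `|scaled_kernel K tau (s - ta)| = \int[@lebesgue_measure R]_u `|K u|.
Proof.
move=> tau0 iK K0; pose aK u := `|K u|.
have aK0 (u : R) : ~~ (- (1 / 2) <= u <= 1 / 2) -> aK u = 0.
  by move=> /K0; rewrite /aK => ->; rewrite normr0.
have := @Rintegral_scaled_kernel _ aK tau ta tau0 aK0 (cst 1).
rewrite (_ : (fun u => aK u * _) = aK); last by apply/funext => u;
  rewrite mulr1.
move=> /(_ (integrable_abse iK)).
move=> E; transitivity (\int[@lebesgue_measure R]_u aK u); last by [].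
rewrite -{1}E; apply: eq_Rintegral => s _.
by rewrite /cst mulr1 /scaled_kernel normrM gtr0_norm// invr_gt0.
Qed.

Section Consistency.
Context {R : realType}.
Local Notation mu := (@lebesgue_measure R).

Lemma kernel_outside p q (K : R -> R) : is_kernel p q K ->
  forall u : R, ~~ (- (1 / 2) <= u <= 1 / 2) -> K u = 0.
Proof.
move=> hK u; apply: contraNeq => Ku.
have /(kernel_supp hK) : closure [set x | K x != 0] u by exact: subset_closure.
by rewrite /= in_itv.
Qed.

(** Local integrability is part of having a weak derivative; compact support makes it global. *)
Lemma kernel_integrable p q (K : R -> R) : is_kernel p q K ->
  mu.-integrable setT (EFin \o K).
Proof.
move=> hK; have [g [[[mK _ lK] _ _] _]] := kernel_BV hK.
have -> : EFin \o K = (EFin \o K) \_ `[- (1 / 2), 1 / 2].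
  apply/funext => u; rewrite patchE; case: ifPn => //.
  rewrite notin_setE /= in_itv/= => /negP hu.
  by rewrite (kernel_outside hK).
apply: (integrable_mkcond _ _).1 => //; apply/integrableP; split.
  by apply/measurable_EFinP; exact: measurable_funTS.
by apply: lK => //; exact: segment_compact.
Qed.

Lemma flux_consistent p (q : int) (K : R -> R) (c1 : R) : -1 <= q ->
  is_kernel p q K -> exists2 C : R, 0 <= C &
  forall (T : R) H, 0 < T -> is_field T c1 H -> forall (eps tau ta : R) M F,
    0 < eps -> eps < tau -> 0 <= ta - tau / 2 -> ta + tau / 2 <= T ->
    is_upscaled_flux H K eps tau ta M F ->
    enorm (F + avg_field H ta *m M) <=
      C * (tau + (eps / tau) ^ (q + 2)) * enorm M.
Proof.
move=> hq hK; have iK := kernel_integrable hK.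
have K0 := kernel_outside hK.
have [g [wK [_ [V bvg]]]] := kernel_BV hK.
set n := absz (q + 1) in wK.
(* As q >= -1, n is q + 1 itself, so the exponent n + 1 of the kernel estimate is q + 2. *)
have qn : q + 2 = n.+1%:Z.
  by rewrite intS /n gez0_abs; [ring|rewrite -lerBlDr sub0r].
(* The kernel estimate needs a strictly positive bound on the field, and C is chosen before any
   field is given. *)
pose k1 := \int[mu]_u `|K u|; pose c : R := `|c1| + 1.
have k10 : 0 <= k1 by exact: Rintegral_ge0.
have c0 : 0 < c by rewrite ltr_wpDl.
(* A is the freezing error weighted by the L1 norm of K; B collects the oscillatory error 4c|V| of
   the three entries of a row. *)
pose A : R := 3 * (c + c ^+ 2) * k1; pose B : R := 12 * c * `|V|.
have A0 : 0 <= A.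
  by rewrite /A !mulr_ge0// addr_ge0 ?sqr_ge0// ltW.
have B0 : 0 <= B by rewrite /B !mulr_ge0// ltW.
exists (3 * (A + B)); first by rewrite mulr_ge0// addr_ge0.
move=> T H T0 hH eps tau ta M F eps0 epstau ta0 taT [m hm ->].
have tau0 : 0 < tau := lt_trans eps0 epstau.
pose dlt := (eps / tau) ^+ n.+1.
have dlt0 : 0 <= dlt by rewrite exprn_ge0// divr_ge0// ltW.
have -> : (eps / tau) ^ (q + 2) = dlt by rewrite qn -exprnP.
have M0 := enorm_ge0 M.
have taT' : 0 <= ta <= T by lra.
have cc1 : c1 <= c by rewrite /c (le_trans (ler_norm _))// lerDl.
have c10 : 0 <= c1 := field_const_ge0 T0 hH.
rewrite -!mulrA; apply: enorm_le => i.
apply: (@le_trans _ _ ((A * tau + B * dlt) * enorm M)); last first.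
  rewrite [leRHS](_ : _ = (A * tau + B * dlt + (A * dlt + B * tau)) * enorm M).
    by rewrite ler_wpM2r// lerDl addr_ge0// mulr_ge0// ltW.
  by ring.
pose w (s : R) := scaled_kernel K tau (s - ta).
pose I : set (measurableTypeR R) := [set` `[ta - tau / 2, ta + tau / 2]].
pose gm (s : R) : R := (- (H s (s / eps) *m m s)) i 0.
pose h j (s : R) : R := H ta s i j.
pose G0 (s : R) : R := \sum_j H ta (s / eps) i j * M j 0.
have mI : measurable I by exact: measurable_itv.
have iw : mu.-integrable I (EFin \o w).
  by apply: integrableS (scaled_kernel_integrable ta tau0 iK).
have ch j : continuous (h j) by exact: (field_continuous hH taT').
have chs j : continuous (fun s : R => h j (s / eps)).
  move=> s; apply: (@continuous_comp _ _ _ (fun y : R => y / eps)) (ch j _).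
  by apply: cvgM; [exact: cvg_id|exact: cvg_cst].
have hc j s : `|h j s| <= c.
  by apply: le_trans cc1; exact: (field_entry_le hH _ _ _ taT').
have iwh j : mu.-integrable I (EFin \o (fun s => w s * h j (s / eps))).
  apply: (@integrable_bounded_mul _ _ _ _ c) => //.
  by apply: measurable_funTS; apply: continuous_measurable_fun; exact: chs.
have iwg : mu.-integrable I (EFin \o (fun s => w s * gm s)).
  apply: (@integrable_bounded_mul _ _ _ _ (c1 * enorm M)) => //.
    apply: subspace_continuous_measurable_fun => //.
    exact: (micro_deriv_continuous T0 hH ta0 taT hm).
  by move=> s; rewrite /I/= in_itv/=;
    exact: (micro_deriv_le hH tau0 ta0 taT hm).
pose X j : R := \int[mu]_(s in I) (w s * h j (s / eps)).
(* In the variable u the field oscillates with frequency b = tau / eps, to which [kernel_cell_le]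
   applies. *)
have XE j : `|X j - avg_field H ta i j| <= 4 * c * `|V| * dlt.
  have hab u : h j ((ta + tau * u) / eps) = h j (ta / eps + tau / eps * u).
    by congr h; ring.
  rewrite /X /w Rintegral_scaled_kernel//; last first.
    apply: (@integrable_bounded_mul _ _ _ _ c) => //.
    under eq_fun do rewrite hab.
    by apply: continuous_measurable_fun; exact: continuous_affine (ch j).
  under eq_Rintegral do rewrite hab.
  have [d [d0 dS]] := field_cell hH i j taT'.
  have b0 : 0 < tau / eps by rewrite divr_gt0.
  have := kernel_cell_le (field_periodic1 hH i j taT') (hc j) d0 dS iK
    (kernel_mass hK) K0 wK bvg (ta / eps) c0 b0.
  rewrite avg_field_mean => /le_trans; apply.
  rewrite -[(tau / eps) ^- _]exprVn invf_div -/dlt.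
  by rewrite ler_wpM2r// ler_wpM2l ?ler_norm// mulr_ge0// ltW.
have G0c s : `|G0 s| <= 3 * (c * enorm M).
  rewrite /G0 sum_ord3; have hM j :
    `|H ta (s / eps) i j * M j 0| <= c * enorm M.
    by rewrite normrM ler_pM// ?hc// coord_le_enorm.
  rewrite (le_trans (ler_normD _ _))//.
  rewrite (le_trans (lerD (lexx _) (ler_normD _ _)))//.
  by have := hM 0; have := hM 1; have := hM 2; lra.
have cG0 : continuous G0.
  rewrite (_ : G0 = fun s => h 0 (s / eps) * M 0 0 +
      (h 1 (s / eps) * M 1 0 + h 2 (s / eps) * M 2 0)).
    by move=> s; repeat apply: cvgD; apply: cvgM;
      by [exact: chs|exact: cvg_cst].
  by apply/funext => s; rewrite /G0 sum_ord3.
have iwG0 : mu.-integrable I (EFin \o (fun s => w s * G0 s)).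
  apply: (@integrable_bounded_mul _ _ _ _ (3 * (c * enorm M))) => //.
  by apply: measurable_funTS; exact: continuous_measurable_fun.
have wG0 : \int[mu]_(s in I) (w s * G0 s) = \sum_j X j * M j 0.
  have iX j : mu.-integrable I (EFin \o (fun s => w s * h j (s / eps) * M j 0)).
    have := integrableZr _ (M j 0) (iwh j).
    by move=> /(_ _)/=; apply.
  rewrite sum_ord3 /X -!RintegralZr//.
  rewrite -[X in _ + X]RintegralD// -RintegralD//;
    last exact: (integrableD mI (iX 1) (iX 2)).
  by apply: eq_Rintegral => s _; rewrite /G0 sum_ord3 /h; ring.
have -> : ((\col_i0 \int[mu]_(s in I) (w s * deriv_in I m s i0 0)) +
    avg_field H ta *m M) i 0 =
    \int[mu]_(s in I) (w s * (gm s + G0 s)) -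
    \sum_j (X j - avg_field H ta i j) * M j 0.
  rewrite !mxE.
  have -> : \int[mu]_(s in I) (w s * deriv_in I m s i 0) =
      \int[mu]_(s in I) (w s * gm s).
    apply: eq_Rintegral => s; rewrite inE /I/= in_itv/= => sI.
    by rewrite (micro_deriv_inE tau0 hm).
  have -> : \int[mu]_(s in I) (w s * (gm s + G0 s)) =
      \int[mu]_(s in I) (w s * gm s) + \int[mu]_(s in I) (w s * G0 s).
    rewrite -RintegralD//.
    by apply: eq_Rintegral => s _; rewrite mulrDr.
  rewrite wG0 !sum_ord3; ring.
have iwgG : mu.-integrable I (EFin \o (fun s => w s * (gm s + G0 s))).
  rewrite (_ : _ \o _ = EFin \o (fun s => w s * gm s + w s * G0 s)).
    exact: (integrableD mI iwg iwG0).
  by apply/funext => s /=; rewrite mulrDr.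
have c2 : 3 * (c1 + c1 ^+ 2) * enorm M * tau <= 3 * (c + c ^+ 2) * enorm M *
  tau.
  rewrite !ler_wpM2r ?(ltW tau0)// ler_wpM2l// lerD// ler_pXn2r ?nnegrE//.
  exact: ltW.
rewrite (le_trans (ler_normB _ _))// mulrDl lerD//.
  rewrite (le_trans (le_normr_Rintegral mI iwgG))//.
  have iaw := integrable_abse iw.
  apply: (@le_trans _ _ (\int[mu]_(s in I)
      (3 * (c + c ^+ 2) * enorm M * tau * `|w s|))).
    apply: le_Rintegral => //; first exact: (integrable_abse iwgG).
      exact: (integrableZl mI _ iaw).
    move=> s; rewrite /I/= in_itv/= => sI; rewrite normrM mulrC ler_wpM2r//.
    by apply: le_trans c2; exact: (micro_deriv_close T0 hH tau0 ta0 taT hm).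
  rewrite RintegralZl// /A.
  rewrite (_ : 3 * (c + c ^+ 2) * k1 * tau * enorm M =
    3 * (c + c ^+ 2) * enorm M * tau * k1); last by ring.
  rewrite ler_wpM2l ?(Rintegral_norm_scaled_kernel ta tau0 iK K0)//.
  by rewrite !mulr_ge0 ?addr_ge0 ?sqr_ge0// ltW.
rewrite sum_ord3.
have XM j : `|(X j - avg_field H ta i j) * M j 0| <= 4 * c * `|V| * dlt * enorm
  M.
  by rewrite normrM ler_pM// coord_le_enorm.
rewrite (le_trans (ler_normD _ _))// (le_trans (lerD (lexx _) (ler_normD _
  _)))//.
by have := XM 0; have := XM 1; have := XM 2; rewrite /B; lra.
Qed.

End Consistency.

(** * Stability of the midpoint rule *)

Section Energy.
Context {R : realType}.

(** Pairing the increment with e + e' gives |e'|^2 - |e|^2 on one side and removes the skew term on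
    the other. Cauchy-Schwarz then allows division by |e| + |e'|; if this sum is zero, both norms
    vanish. *)
Lemma midpoint_step_le (A : 'M[R]_3) (dt : R) (e e' r : 'cV[R]_3) :
  0 <= dt -> (forall i j, A i j = - A j i) ->
  e' = e + dt *: (r - A *m (2^-1 *: (e + e'))) ->
  enorm e' <= enorm e + dt * enorm r.
Proof.
move=> dt0 skA eE.
have [s0|s0] := eqVneq (enorm e + enorm e') 0.
  have := enorm_ge0 e; have := enorm_ge0 e'.
  by have := mulr_ge0 dt0 (enorm_ge0 r); lra.
have sp : 0 < enorm e + enorm e' by rewrite lt_def s0 addr_ge0 ?enorm_ge0.
have dE : dotv (dt *: (r - A *m (2^-1 *: (e + e')))) (e + e') =
    enorm e' ^+ 2 - enorm e ^+ 2.
  move: (dt *: _) eE => d ->.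
  by rewrite !sqr_enorm /dotv !sum_ord3 !mxE; ring.
have : dotv (dt *: (r - A *m (2^-1 *:
  (e + e')))) (e + e') = dt * dotv r (e + e').
  rewrite dotvZl dotvDl -scaleN1r dotvZl -scalemxAr dotvZl dotv_skew//.
  by rewrite !mulr0 addr0.
rewrite dE => {}dE.
have := le_trans (dotv_le r (e + e')) (ler_wpM2l (enorm_ge0 r) (enormD e e')).
move/(ler_wpM2l dt0); rewrite -dE => h.
have : (enorm e' - enorm e) * (enorm e + enorm e') <=
    dt * enorm r * (enorm e + enorm e') by lra.
by rewrite ler_pM2r//; lra.
Qed.

Lemma grid_midE (dt : R) n : grid_mid dt n = n%:R * dt + dt / 2.
Proof. by rewrite /grid_mid /grid -natr1; field. Qed.

(** From (sqrt T - 1)^2 >= 0 follows sqrt T <= (1 + T)/2 <= 1 + 3T/4 <= exp(3T/4). *)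
Lemma le_sqrt_expR (T : R) : 0 < T -> T <= Num.sqrt T * expR (3 / 4 * T).
Proof.
move=> T0; have s0 : 0 <= Num.sqrt T by exact: sqrtr_ge0.
have sE : Num.sqrt T ^+ 2 = T by rewrite sqr_sqrtr// ltW.
rewrite -{1}sE expr2 ler_wpM2l// (le_trans _ (expR_ge1Dx _))//.
by have := sqr_ge0 (Num.sqrt T - 1); rewrite sqrrB1 sE; lra.
Qed.

End Energy.

(** * Accumulation of the consistency errors over the grid *)

Unset Implicit Arguments.

Theorem theorem2 (R : realType) (p : nat) (q : int) (hq : -1 <= q)
    (K : R -> R) (hK : is_kernel p q K) (H : R -> R -> 'M[R]_3) (c1 : R) :
  exists C : R,
  forall T : R, 0 < T -> is_field T c1 H ->
  forall (N : nat) (dt eps tau : R),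
    (1 <= N)%N -> dt = T / N%:R -> dt <= 2 / 3 ->
    0 < eps -> eps < tau -> tau < dt -> eps < 1 ->
  forall F : R -> 'cV[R]_3 -> 'cV[R]_3,
    (forall (ta : R) (M : 'cV[R]_3), 0 <= ta - tau / 2 -> ta + tau / 2 <= T ->
       is_upscaled_flux H K eps tau ta M (F ta M)) ->
  forall M mbar : nat -> 'cV[R]_3,
    (forall n, (n < N)%N ->
       M n.+1 = M n + dt *: F (grid_mid dt n) (midpoint M n)) ->
    (forall n, (n < N)%N ->
       mbar n.+1 =
         mbar n - dt *: (avg_field H (grid_mid dt n) *m midpoint mbar n)) ->
    M 0%N = mbar 0%N -> enorm (M 0%N) = 1 ->
    enorm (M N - mbar N) <=
      C * Num.sqrt T * (tau + (eps / tau) ^ (q + 2)) * expR (3 / 4 * T) *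
      \big[Num.max/0]_(n < N) enorm (midpoint M n).
Proof.
have [C C0 hC] := flux_consistent c1 hq hK.
exists C => T T0 hH N dt eps tau N1 dtE _ eps0 epstau taudt _ F hF M mbar hM
  hmbar.
move=> M0 _; set mx := \big[Num.max/0]_(n < N) _.
have N0 : 0 < N%:R :> R by rewrite ltr0n.
have dt0 : 0 < dt by rewrite dtE divr_gt0.
have TE : N%:R * dt = T by rewrite dtE mulrC divfK// gt_eqF.
set dlt := (eps / tau) ^ (q + 2).
have dlt0 : 0 <= tau + dlt.
  by rewrite addr_ge0 ?exprz_ge0 ?divr_ge0// ltW// (lt_trans eps0).
have step n : (n < N)%N -> enorm (M n.+1 - mbar n.+1) <=
    enorm (M n - mbar n) + dt * (C * (tau + dlt) * mx).
  move=> nN; have nN' : n.+1%:R * dt <= T by rewrite -TE ler_wpM2r ?ler_nat//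
    ltW.
  rewrite -natr1 mulrDl mul1r in nN'.
  have n0 : 0 <= n%:R * dt by rewrite mulr_ge0// ltW.
  (* Since tau < dt, the window around the midpoint stays inside the grid cell and hence inside
     [0, T]. *)
  have ta0 : 0 <= grid_mid dt n - tau / 2 by rewrite grid_midE; lra.
  have taT : grid_mid dt n + tau / 2 <= T by rewrite grid_midE; lra.
  have tT : 0 <= grid_mid dt n <= T by lra.
  have := hC T H T0 hH _ _ _ _ _ eps0 epstau ta0 taT (hF _ (midpoint M n) ta0
    taT).
  set A := avg_field H _; set r := _ + _ => hr.
  apply: (@le_trans _ _ (enorm (M n - mbar n) + dt * enorm r)).
    apply: (@midpoint_step_le _ A); first exact: ltW.
      by move=> i j; exact: (avg_field_anti hH _ _ tT).
    (* The errors obey the averaged midpoint scheme with the consistency error r, evaluated along M,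
       as source. *)
    have -> : 2^-1 *: (M n - mbar n + (M n.+1 - mbar n.+1)) =
        midpoint M n - midpoint mbar n.
      by rewrite /midpoint -scalerBr; congr (_ *: _); rewrite opprD addrACA.
    rewrite (hM _ nN) (hmbar _ nN) /r -/A mulmxBr.
    move: (F _ _) (A *m midpoint M n) (A *m midpoint mbar n) => f a b.
    by apply/colP => i; rewrite !mxE; ring.
  rewrite lerD2l ler_pM2l// (le_trans hr)// ler_wpM2l ?mulr_ge0//.
  exact: (le_bigmax _ (fun n : 'I_N => enorm (midpoint M n)) (Ordinal nN)).
(* The local bound does not depend on n, so the errors add up linearly; at n = N the factor N dt is
   T. *)
have all n : (n <= N)%N ->
    enorm (M n - mbar n) <= n%:R * (dt * (C * (tau + dlt) * mx)).
  elim: n => [_|n IH nN].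
    by rewrite M0 subrr mul0r enormE /dotv big1 ?sqrtr0// => i _;
      rewrite !mxE mul0r.
  rewrite (le_trans (step _ nN))// -natr1 mulrDl mul1r lerD2r IH//; exact: ltnW.
rewrite (le_trans (all N (leqnn N)))// mulrA TE.
have mx0 : 0 <= mx by exact: bigmax_ge_id.
rewrite [leRHS](_ : _ = Num.sqrt T * expR (3 / 4 * T) * (C * (tau + dlt) *
  mx)); last by ring.
by rewrite ler_wpM2r ?le_sqrt_expR// !mulr_ge0.
Qed.
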